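(* Let $X=(X(t))_{t\in[0,T]}$ be an $\mathbb{F}$-adapted process and suppose that $(f,\xi,L)$, with driver $(t,s)\mapsto f(t,s,X(s))$, satisfies the assumptions (A1), (A2) and (A3) listed in the context. For $t\in[0,T]$ and an $\mathbb{F}$-stopping time $\tau$ with values in $[t,T]$ put $$J(t,\tau):=\mathbb{E}\left[\int_t^{\tau}f(t,s,X(s))\,ds+L(\tau)\mathbf{1}_{\{\tau<T\}}+\xi(t)\mathbf{1}_{\{\tau=T\}}\right],$$ and $$Y(t):=\underset{\tau\ge t}{\operatorname{ess\,sup}}\;\mathbb{E}\left[\int_t^{\tau}f(t,s,X(s))\,ds+L(\tau)\mathbf{1}_{\{\tau<T\}}+\xi(t)\mathbf{1}_{\{\tau=T\}}\,\Big|\,\mathcal{F}_t\right],$$ the essential supremum being over $\mathbb{F}$-stopping times $\tau$ with values in $[t,T]$. For each $t\in[0,T]$ let $\widetilde{Y}(t,\cdot)$ be the first component of the accompanying reflected BSDE parametrized by $t$ (defined in the context; it satisfies $\widetilde{Y}(t,t)=Y(t)$), and denote by $\tau_t^*$ the stopping time $$\tau^*_t=\inf\{t\le u\le T:\ \widetilde{Y}(t,u)=L(u)\},$$ with the convention that $\tau^*_t=T$ if $\widetilde{Y}(t,u)>L(u)$ for all $t\le u\le T$. Then $\tau^*_t$ is optimal in the sense that $$Y(t)=\mathbb{E}\left[\int_t^{\tau^*_t}f(t,s,X(s))\,ds+L(\tau^*_t)\mathbf{1}_{\{\tau^*_t<T\}}+\xi(t)\mathbf{1}_{\{\tau^*_t=T\}}\,\Big|\,\mathcal{F}_t\right].$$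 Moreover, $\tau_t^*$ is an optimal strategy for $J(t,\cdot)$, i.e. $\tau^*_t$ attains the maximum: $J(t,\tau_t^* )=\sup_{\tau\ge t}J(t,\tau)$, the supremum being over $\mathbb{F}$-stopping times $\tau$ with values in $[t,T]$.
   Context: Setting. $T>0$ is fixed, $(\Omega,\mathcal{F},\mathbb{P})$ is a complete probability space carrying a standard one-dimensional Brownian motion $W=(W(t))_{0\le t\le T}$, and $\mathbb{F}=(\mathcal{F}_t)_{0\le t\le T}$ is its natural filtration augmented by all $\mathbb{P}$-null sets. $\mathcal{S}^2$ is the set of $\mathbb{F}$-adapted real processes $Y$ with $\mathbb{E}[\sup_{t\in[0,T]}|Y(t)|^2]<\infty$, and $\mathcal{H}^2$ the set of $\mathbb{F}$-adapted real processes $v$ with $\mathbb{E}[\int_0^T|v(s)|^2ds]<\infty$. Accompanying reflected BSDE. For each fixed $t\in[0,T]$, $(\widetilde{Y}(t,\cdot),Z(t,\cdot),K(t,\cdot))$ is the unique solution of the reflected BSDE associated with $(f(t,s,X(s)),L(s),\xi(t))$, $$\widetilde{Y}(t,u)=\xi(t)+\int_{u}^{T}f(t,s,X(s))\,ds+\int_u^TK(t,ds)-\int_{u}^{T} Z(t,s)\,dW(s),\quad u\in[t,T],$$ such that (d) $\widetilde{Y}(t,\cdot)\in\mathcal{S}^2$, $K(t,T)\in L^2(\mathbb{P})$, $Z(t,\cdot)\in\mathcal{H}^2$; (e) $\widetilde{Y}(t,u)\ge L(u)$ $\mathbb{P}$-a.s. for all $u$; (f) $K(t,\cdot)$ is continuous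 and increasing, $K(t,0)=0$, and it satisfies the Skorohod flatness condition: for each $0\le a<b\le T$, $\mathbb{P}$-a.s., $K(t,a)=K(t,b)$ whenever $\widetilde{Y}(t,u)>L(u)$ for each $u\in[a,b]$ (equivalently $\int_t^T(\widetilde{Y}(t,u)-L(u))\,K(t,du)=0$ $\mathbb{P}$-a.s.). Here $\int_u^TK(t,ds)=K(t,T)-K(t,u)$. Assumptions on $(f,\xi,L)$ (for the driver $(t,s)\mapsto f(t,s,X(s))$, which does not depend on the unknowns of the equation). (A1) $\xi:\Omega\times[0,T]\to\mathbb{R}$ is $\mathcal{F}_T\otimes\mathcal{B}([0,T])$-measurable and $\sup_{0\le t\le T}\mathbb{E}[|\xi(t)|^2]<\infty$. (A2) For any fixed $t$, the process $s\mapsto f(t,s,X(s))$ is real-valued and progressively measurable, and: (A2-a) $\sup_{0\le t\le T}\mathbb{E}[(\int_t^T|f(t,s,X(s))|ds)^2]<\infty$; (A2-c) for some $\alpha\in(0,1/2]$ and $c_1>0$, for all $0\le t,t'\le s\le T$, $|f(t',s,X(s))-f(t,s,X(s))|\le c_1|t'-t|^{\alpha}$; and for some $\beta>1/\alpha$ and $c_2>0$, $\mathbb{E}[|\xi(t)-\xi(t')|^\beta]\le c_2|t'-t|^{\alpha\beta}$ for all $t,t'\in[0,T]$, and $\mathbb{E}[(\int_0^T|f(0,s,X(s))|^2ds)^{\beta/2}]<\infty$. (The Lipschitz condition (A2-b) in the unknowns $(y,z)$ is vacuous here.) (A3) $L=(L(u))_{0\le u\le T}$ is a real-valued $\mathbb{F}$-adapted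 continuous process with $L(T)\le\xi(t)$ for all $t\in[0,T]$ and $\mathbb{E}[\sup_{0\le u\le T}(L^+(u))^2]<\infty$. *)

(* Defs.v *)
From HB Require Import structures.
From mathcomp Require Import all_boot all_order all_algebra.
From mathcomp Require Import all_classical all_reals all_analysis.
From mathcomp Require Import measurable_realfun.

Set Implicit Arguments.
Unset Strict Implicit.
Unset Printing Implicit Defensive.

Import Order.TTheory GRing.Theory Num.Theory.
Import numFieldNormedType.Exports.

Local Open Scope classical_set_scope.
Local Open Scope ring_scope.

(* A process on the time interval [0, T] is a function of a real time and of
   omega; only its values at times in [0, T] are used.  A sub-sigma-algebra is
   a set of sets, and a filtration is a family of such sets indexed by time. *)

Section measurability.
Context {R : realType} {d : measure_display} {Omega : measurableType d}.

Definition sub_measurable {d'} {E : measurableType d'}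
    (G : set (set Omega)) (X : Omega -> E) : Prop :=
  preimage_set_system setT X measurable `<=` G.

Definition adapted {d'} {E : measurableType d'} (T : R)
    (F : R -> set (set Omega)) (X : R -> Omega -> E) : Prop :=
  forall t : R, 0 <= t <= T -> sub_measurable (F t) (X t).

Definition rectangles_sigma (G : set (set Omega)) : set (set (R * Omega)) :=
  <<s [set B `*` A | B in (measurable : set (set R)) & A in G] >>.

(* Measurability of v restricted to [0, u] x Omega for B([0, u]) (x) G. *)
Definition jointly_measurable (u : R) (G : set (set Omega))
    (v : R -> Omega -> R) : Prop :=
  preimage_set_system (`[0, u] `*` setT) (fun p : R * Omega => v p.1 p.2)
    measurable `<=` rectangles_sigma G.

Definition progressively_measurable (T : R) (F : R -> set (set Omega))
    (v : R -> Omega -> R) : Prop :=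
  forall u : R, 0 <= u <= T -> jointly_measurable u (F u) v.

Definition continuous_path (T : R) (X : R -> Omega -> R) (w : Omega) : Prop :=
  {within `[0, T], continuous (fun t => X t w)}.

End measurability.

Section brownian_motion.
Context {R : realType} {d : measure_display} {Omega : measurableType d}.
Variables (P : probability Omega R) (W : R -> Omega -> R).

Definition events_upto (t : R) : set (set Omega) :=
  \bigcup_(s in `[0, t]) preimage_set_system setT (W s) measurable.

Definition brownian_filtration (t : R) : set (set Omega) :=
  <<s events_upto t `|` [set N | P.-negligible N] >>.

Record standard_brownian_motion (T : R) : Prop := {
  bm_measurable : forall t : R, 0 <= t <= T -> measurable_fun setT (W t) ;
  bm_start : {ae P, forall w, W 0 w = 0} ;
  (* the second argument of normal_prob is the standard deviation *)
  bm_increment : forall (s t : R) (B : set R), 0 <= s -> s < t -> t <= T ->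
    measurable B ->
    P ((W t \- W s) @^-1` B) = normal_prob 0 (Num.sqrt (t - s)) B ;
  bm_independent : forall (s t : R) (A : set Omega) (B : set R),
    0 <= s -> s < t -> t <= T ->
    <<s events_upto s >> A -> measurable B ->
    (P (A `&` (W t \- W s)%R @^-1` B) = P A * P ((W t \- W s)%R @^-1` B))%E ;
  bm_continuous : {ae P, forall w, continuous_path T W w} }.

End brownian_motion.

Section conditional_expectation.
Context {R : realType} {d : measure_display} {Omega : measurableType d}.
Variable P : probability Omega R.

(* Y is a version of E[X | G].  X is only required to have an integrable
   positive or negative part, so that E[X | G] takes extended real values. *)
Record is_cond_exp (G : set (set Omega)) (X Y : Omega -> \bar R) : Prop := {
  ce_source_measurable : measurable_fun setT X ;
  ce_quasi_integrable :
    (\int[P]_w (X^\+ w) < +oo)%E \/ (\int[P]_w (X^\- w) < +oo)%E ;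
  ce_measurable : sub_measurable G Y ;
  ce_integral : forall A, G A ->
    (\int[P]_(w in A) Y w = \int[P]_(w in A) X w)%E }.

(* g is a version of the essential supremum of the family S of random
   variables (the library's ess_sup is that of a single function). *)
Record is_ess_sup (S : set (Omega -> \bar R)) (g : Omega -> \bar R) : Prop := {
  es_measurable : measurable_fun setT g ;
  es_upper : forall h, S h -> {ae P, forall w, (h w <= g w)%E} ;
  es_least : forall g', measurable_fun setT g' ->
    (forall h, S h -> {ae P, forall w, (h w <= g' w)%E}) ->
    {ae P, forall w, (g w <= g' w)%E} }.

End conditional_expectation.

Section spaces.
Context {R : realType} {d : measure_display} {Omega : measurableType d}.
Variables (P : probability Omega R) (T : R) (F : R -> set (set Omega)).

Definition in_S2 (Y : R -> Omega -> R) : Prop :=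
  adapted T F Y /\
  (\int[P]_w ereal_sup [set (`|Y t w| ^+ 2)%:E | t in `[0%R, T]] < +oo)%E.

(* Joint measurability is what gives a meaning to the time integral. *)
Definition in_H2 (v : R -> Omega -> R) : Prop :=
  [/\ adapted T F v,
      jointly_measurable T measurable v &
      (\int[P]_w \int[lebesgue_measure]_(s in `[0%R, T]) (`|v s w| ^+ 2)%:E
         < +oo)%E].

Definition in_L2 (X : Omega -> R) : Prop :=
  measurable_fun setT X /\ (\int[P]_w (`|X w| ^+ 2)%:E < +oo)%E.

End spaces.

Section ito_integral.
Context {R : realType} {d : measure_display} {Omega : measurableType d}.
Variables (P : probability Omega R) (T : R) (F : R -> set (set Omega)).
Variable W : R -> Omega -> R.

(* The data of sum_(i < n) h_i 1_{]p_i, p_(i+1)]}. *)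
Record simple_process := SimpleProcess {
  sp_size : nat ;
  sp_time : nat -> R ;
  sp_coef : nat -> Omega -> R }.

Record simple_process_ok (phi : simple_process) : Prop := {
  sp_start : sp_time phi 0 = 0 ;
  sp_end : sp_time phi (sp_size phi) = T ;
  sp_nondecreasing : forall i, (i < sp_size phi)%N ->
    sp_time phi i <= sp_time phi i.+1 ;
  sp_measurable : forall i, (i < sp_size phi)%N ->
    sub_measurable (F (sp_time phi i)) (sp_coef phi i) ;
  sp_bounded : forall i, (i < sp_size phi)%N ->
    exists C : R, forall w, `|sp_coef phi i w| <= C }.

Definition simple_value (phi : simple_process) (s : R) (w : Omega) : R :=
  \sum_(i < sp_size phi)
    sp_coef phi i w * \1_(`]sp_time phi i, sp_time phi i.+1]) s.

Definition simple_integral (phi : simple_process) (u : R) (w : Omega) : R :=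
  \sum_(i < sp_size phi) sp_coef phi i w *
    (W (Num.min (sp_time phi i.+1) u) w - W (Num.min (sp_time phi i) u) w).

(* M is the continuous version of u |-> int_0^u v dW, 0 <= u <= T, obtained
   as an L^2-limit of the integrals of simple processes approximating v in
   L^2(dP x ds). *)
Definition is_ito_integral (v M : R -> Omega -> R) : Prop :=
  [/\ adapted T F M,
      {ae P, forall w, continuous_path T M w} &
      exists phi : nat -> simple_process,
        [/\ forall n, simple_process_ok (phi n),
            (fun n => \int[P]_w \int[lebesgue_measure]_(s in `[0%R, T])
               (`|v s w - simple_value (phi n) s w| ^+ 2)%:E)%E
               @ \oo --> 0%E &
            forall u : R, 0 <= u <= T ->
              (fun n => \int[P]_w
                 (`|M u w - simple_integral (phi n) u w| ^+ 2)%:E)%E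
                 @ \oo --> 0%E]].

End ito_integral.

Section optimal_stopping.
Context {R : realType} {d : measure_display} {Omega : measurableType d}.
Variables (P : probability Omega R) (T : R) (F : R -> set (set Omega)).

(* g : the driver, g t s w standing for f(t, s, X(s)) at w. *)
Variables (g : R -> R -> Omega -> R) (xi : R -> Omega -> R).
Variable L : R -> Omega -> R.

Record assumption_A1 : Prop := {
  A1_measurable : jointly_measurable T (F T) xi ;
  A1_moment : (ereal_sup
    [set \int[P]_w (`|xi t w| ^+ 2)%:E | t in `[0%R, T]] < +oo)%E }.

Definition assumption_A2a : Prop :=
  (ereal_sup [set \int[P]_w
     (\int[lebesgue_measure]_(s in `[t, T]) `|g t s w|%:E) ^+ 2
     | t in `[0%R, T]] < +oo)%E.

Definition assumption_A2c : Prop :=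
  exists alpha c1 : R,
    [/\ 0 < alpha, alpha <= 1 / 2, 0 < c1,
        forall t t' s : R, 0 <= t -> 0 <= t' -> t <= s -> t' <= s -> s <= T ->
          {ae P, forall w,
             `|g t' s w - g t s w| <= c1 * `|t' - t| `^ alpha} &
        exists beta c2 : R,
          [/\ alpha^-1 < beta, 0 < c2,
              forall t t' : R, 0 <= t <= T -> 0 <= t' <= T ->
                (\int[P]_w (`|xi t w - xi t' w| `^ beta)%:E
                   <= (c2 * `|t' - t| `^ (alpha * beta))%:E)%E &
              (\int[P]_w
                (\int[lebesgue_measure]_(s in `[0%R, T])
                   (`|g 0%R s w| ^+ 2)%:E) `^ (beta / 2) < +oo)%E]].

Record assumption_A2 : Prop := {
  A2_progressive : forall t : R, 0 <= t <= T -> progressively_measurable T F (g t) ;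
  A2_a : assumption_A2a ;
  A2_c : assumption_A2c }.

Record assumption_A3 : Prop := {
  A3_adapted : adapted T F L ;
  A3_continuous : {ae P, forall w, continuous_path T L w} ;
  A3_terminal : forall t : R, 0 <= t <= T -> {ae P, forall w, L T w <= xi t w} ;
  A3_moment :
    (\int[P]_w ereal_sup [set (Num.max (L u w) 0 ^+ 2)%:E | u in `[0%R, T]]
       < +oo)%E }.

(* The reflected BSDE on [t, T] with driver g t, barrier L and terminal value
   xi t; M stands for the stochastic integral of Z against W. *)
Record reflected_bsde_solution (W : R -> Omega -> R) (t : R)
    (Y Z K : R -> Omega -> R) : Prop := {
  rb_equation : exists2 M : R -> Omega -> R,
    is_ito_integral P T F W Z M &
    {ae P, forall w, forall u : R, t <= u <= T ->
       Y u w = xi t w + \int[lebesgue_measure]_(s in `[u, T]) g t s w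
               + (K T w - K u w) - (M T w - M u w)} ;
  rb_Y : in_S2 P T F Y ;
  rb_K : in_L2 P (K T) ;
  rb_Z : in_H2 P T F Z ;
  rb_barrier : forall u : R, t <= u <= T -> {ae P, forall w, L u w <= Y u w} ;
  rb_K_continuous : {ae P, forall w, continuous_path T K w} ;
  rb_K_increasing : {ae P, forall w, forall a b : R,
    0 <= a -> a <= b -> b <= T -> K a w <= K b w} ;
  rb_K_start : {ae P, forall w, K 0 w = 0} ;
  rb_K_flat : forall a b : R, 0 <= a -> a < b -> b <= T ->
    {ae P, forall w, (forall u : R, a <= u <= b -> L u w < Y u w) ->
       K a w = K b w} }.

Definition stopping_time_from (t : R) (tau : Omega -> R) : Prop :=
  (forall w, t <= tau w <= T) /\
  (forall u : R, 0 <= u <= T -> F u [set w | tau w <= u]).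

Definition payoff (t : R) (tau : Omega -> R) (w : Omega) : R :=
  \int[lebesgue_measure]_(s in `[t, tau w]) g t s w
  + L (tau w) w * \1_[set w' | tau w' < T] w
  + xi t w * \1_[set w' | tau w' = T] w.

Definition J (t : R) (tau : Omega -> R) : \bar R := 'E_P[payoff t tau].

(* Y is (a version, at time t, of) the value process. *)
Definition is_value (t : R) (Y : Omega -> \bar R) : Prop :=
  is_ess_sup P
    [set h | exists2 tau, stopping_time_from t tau &
       is_cond_exp P (F t) (EFin \o payoff t tau) h] Y.

(* Adding T to the hitting set encodes the convention that the infimum is T
   when the barrier is not hit, and changes nothing otherwise. *)
Definition first_contact (t : R) (Y : R -> Omega -> R) (w : Omega) : R :=
  inf ([set u | t <= u <= T /\ Y u w = L u w] `|` [set T]).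

End optimal_stopping.

Definition driver {R : realType} {Omega E : Type} (f : R -> R -> E -> Omega -> R)
    (X : R -> Omega -> E) (t s : R) (w : Omega) : R := f t s (X s w) w.

(* Main.v *)
(* Fix t and let M be the stochastic integral of Z.  Subtracting the reflected
   equation at two times gives, along almost every path,
     Ytilde(t, u) = Ytilde(t, t) - int_t^u f ds - (K(u) - K(t)) + (M(u) - M(t)).
   Since Ytilde >= L, Ytilde(t, T) = xi(t) and K increases, the payoff of any
   stopping time tau is at most Ytilde(t, t) + M(tau) - M(t); at the first contact
   time the barrier is attained and, by flatness, K has not moved since t, so that
   equality holds.  Hence it suffices that E[M(tau) - M(t) | F_t] = 0.  M is an
   L^2-limit of integrals of simple processes, so E[M(T) - M(u) | F_u] = 0 for every
   fixed u; a stopping time is reached by summing the increments of M over the steps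
   of a finer and finer grid that precede it, and the passage to the limit is by
   dominated convergence: the equation itself bounds sup |M - M(t)| by
   2 sup |Ytilde| + int |f| ds + K(T), which is integrable. *)
Require Import Defs.
From HB Require Import structures.
From mathcomp Require Import all_boot all_order all_algebra.
From mathcomp Require Import all_classical all_reals all_analysis.
From mathcomp Require Import measurable_realfun.
From mathcomp Require Import ring lra.

Set Implicit Arguments.
Unset Strict Implicit.
Unset Printing Implicit Defensive.

Import Order.TTheory GRing.Theory Num.Theory.
Import numFieldNormedType.Exports.

Local Open Scope classical_set_scope.
Local Open Scope ring_scope.

(** * Gaussian moments *)

(** Two gaps separate the hypotheses from a pathwise argument. The barrier inequality and flatness
    hold for each fixed time or interval, outside a null set that depends on it, yet they are used
    at a random time. They are therefore collected on the countable set of grid points and extended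
    by continuity of the paths; that of Y is not assumed but read off the equation. Likewise,
    membership of the contact event in the filtration is decided by grid values, up to a null set
    that the augmentation absorbs. On the other side, independence of increments is given only for
    the unaugmented past of W, so an event of the augmented filtration is replaced by an event of
    the past that differs from it by a null set. Finally, conditional expectations are never
    constructed: E[D | G] = 0 is expressed by integrals over the events of G, a property stable
    under sums, bounded G-measurable factors and dominated limits. *)

Lemma ge0_integral_normal_prob (R : realType) (m s : R) (f : R -> R) :
  (forall x, 0 <= f x) -> measurable_fun setT f ->
  (\int[normal_prob m s]_x (f x)%:E =
   \int[lebesgue_measure]_x (f x * normal_pdf m s x)%:E)%E.
Proof.
move=> f0 mf.
have ms := normal_prob_dominates m s.
have mE : measurable_fun [set: R] (EFin \o f) by exact/measurable_EFinP.
rewrite -(Radon_Nikodym_SigmaFinite.change_of_variables ms)//.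
under [RHS]eq_integral do rewrite EFinM.
have mpdf : measurable_fun [set: R] (EFin \o normal_pdf m s).
  by apply/measurable_EFinP; exact: measurable_normal_pdf.
have iRN := Radon_Nikodym_SigmaFinite.f_integrable ms.
(* The Radon-Nikodym derivative and the density have the same integral over every measurable set,
   hence agree almost everywhere. *)
apply: ae_eq_integral => //.
- by apply: emeasurable_funM => //; exact: (measurable_int lebesgue_measure).
- exact: emeasurable_funM.
- apply: ae_eqe_mul2l; apply: integral_ae_eq => //.
  by move=> A _ mA; rewrite -Radon_Nikodym_SigmaFinite.f_integral.
Qed.

(* AM-GM gives |x| <= s (1 + x^2 / (4 s^2)) <= s exp (x^2 / (4 s^2)), which turns
   the Gaussian weight of standard deviation s into that of s sqrt 2. *)
Lemma normal_prob_abs_lty (R : realType) (s : R) : 0 < s ->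
  (\int[normal_prob 0 s]_x `|x|%:E < +oo)%E.
Proof.
move=> s0; have s20 : 0 < s * Num.sqrt 2 by rewrite mulr_gt0// sqrtr_gt0.
have s_neq0 : s != 0 by rewrite gt_eqF.
have s2_neq0 : s * Num.sqrt 2 != 0 by rewrite gt_eqF.
have peak0 : 0 < normal_peak (s * Num.sqrt 2) by exact: normal_peak_gt0.
rewrite ge0_integral_normal_prob//.
(* The ratio of the peaks converts the normalisation of one Gaussian density into that of the
   other. *)
pose c := s * normal_peak s / normal_peak (s * Num.sqrt 2).
have c0 : 0 <= c by rewrite divr_ge0 ?normal_peak_ge0// mulr_ge0 ?normal_peak_ge0// ltW.
apply: (@le_lt_trans _ _ (\int[lebesgue_measure]_x
    (c * normal_pdf 0 (s * Num.sqrt 2) x)%:E)%E); last first.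
  under eq_integral do rewrite EFinM.
  rewrite ge0_integralZl//; last 2 first.
  - by apply/measurable_EFinP; exact: measurable_normal_pdf.
  - by move=> x _; rewrite lee_fin normal_pdf_ge0.
  by rewrite integral_normal_pdf mule1 ltry.
apply: ge0_le_integral => //=.
- by move=> x _; rewrite lee_fin mulr_ge0// normal_pdf_ge0.
- by apply/measurable_EFinP; apply: measurable_funM => //;
    exact: measurable_normal_pdf.
- by apply/measurable_EFinP; apply: measurable_funM => //;
    exact: measurable_normal_pdf.
move=> x _; rewrite lee_fin !normal_pdfE// /c.
rewrite [leRHS](_ : _ = s * normal_peak s * normal_fun 0 (s * Num.sqrt 2) x); last first.
  by rewrite mulrA divfK// gt_eqF.
rewrite [leLHS]mulrCA (mulrC s) -[leRHS]mulrA ler_wpM2l ?normal_peak_ge0//.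
rewrite /normal_fun !subr0 exprMn sqr_sqrtr//.
set v := x ^+ 2 / (s ^+ 2 *+ 4).
have vE : - x ^+ 2 / (s ^+ 2 *+ 2) = - v - v by rewrite /v; field.
have vE' : - x ^+ 2 / ((s ^+ 2 * 2) *+ 2) = - v by rewrite /v; field.
rewrite vE vE' expRD mulrA ler_wpM2r ?expR_ge0//.
rewrite expRN ler_pdivrMr ?expR_gt0//.
apply: (@le_trans _ _ (s * (1 + v))); last by rewrite ler_wpM2l ?expR_ge1Dx// ltW.
suff : 0 <= s * (1 - `|x| / (2 * s)) ^+ 2.
  have -> : s * (1 - `|x| / (2 * s)) ^+ 2 = s * (1 + `|x| ^+ 2 / (s ^+ 2 *+ 4)) - `|x|.
    by field.
  by rewrite real_normK ?num_real// subr_ge0.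
by rewrite mulr_ge0 ?sqr_ge0// ltW.
Qed.

(** The density is even, so the reflection x |-> -x exchanges the two half-lines. This is the
    vanishing of the Gaussian mean, put on positive and negative parts so that only nonnegative
    integrals occur. *)
Lemma normal_prob_pos_neg (R : realType) (s : R) : 0 < s ->
  (\int[normal_prob 0 s]_x (Num.max x 0)%:E =
   \int[normal_prob 0 s]_x (Num.max (- x) 0)%:E)%E.
Proof.
move=> s0; have s_neq0 : s != 0 by rewrite gt_eqF.
have ge0 (h : R -> R) x : 0 <= Num.max (h x) 0 by rewrite le_max lexx orbT.
have mN : measurable_fun [set: R] (fun x : R => Num.max (- x) 0).
  by apply: measurable_maxr => //; exact: oppr_measurable.
have mI : measurable_fun [set: R] (fun x : R => Num.max x 0).
  by exact: measurable_maxr.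
have mpdf := @measurable_normal_pdf R 0 s.
rewrite !ge0_integral_normal_prob//; last by move=> x; exact: (ge0 id).
have mfp : measurable_fun [set: R]
    (fun x => (Num.max x 0 * normal_pdf 0 s x)%:E).
  by apply/measurable_EFinP; exact: measurable_funM.
have mfn : measurable_fun [set: R]
    (fun x => (Num.max (- x) 0 * normal_pdf 0 s x)%:E).
  by apply/measurable_EFinP; exact: measurable_funM.
transitivity (\int[lebesgue_measure]_(x in `[0%R, +oo[)
    (x * normal_pdf 0 s x)%:E)%E.
  rewrite [RHS]integral_mkcond; apply: eq_integral => x _.
  rewrite patchE; case: ifPn; rewrite ?inE ?notin_setE /= in_itv/= andbT.
    by move=> x0; rewrite max_l.
  by move=> /negP; rewrite -ltNge => x0; rewrite max_r ?mul0r// ltW.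
transitivity (\int[lebesgue_measure]_(x in `]-oo, 0%R])
    (- x * normal_pdf 0 s x)%:E)%E; last first.
  rewrite [LHS]integral_mkcond; apply: eq_integral => x _.
  rewrite patchE; case: ifPn; rewrite ?inE ?notin_setE /= in_itv/=.
    by move=> x0; rewrite max_l// oppr_ge0.
  by move=> /negP; rewrite -ltNge => x0; rewrite max_r ?mul0r// oppr_le0 ltW.
have := @ge0_integration_by_substitutionNy R (fun x => - x * normal_pdf 0 s x) 0.
rewrite oppr0 => ->.
- apply: eq_integral => x _ /=; congr EFin.
  by rewrite opprK !normal_pdfE// /normal_fun !subr0 sqrrN.
- apply: continuous_subspaceT => x; apply: cvgM; first exact: (@cvgN _ R^o).
  exact: continuous_normal_pdf.
- move=> x; rewrite in_itv/= => x0.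
  by rewrite mulr_ge0 ?normal_pdf_ge0// oppr_ge0 ltW.
Qed.

(** * Vanishing conditional expectations *)

Section null_conditional_expectation.
Context {R : realType} {d : measure_display} {Omega : measurableType d}.
Variable P : probability Omega R.
Implicit Types (G : set (set Omega)) (D H : Omega -> R).

(* E[D | G] = 0 *)
Definition centered G D := P.-integrable setT (EFin \o D) /\
  forall A, G A -> (\int[P]_(w in A) (D w)%:E = 0)%E.

Lemma sub_centered G G' D : G' `<=` G -> centered G D -> centered G' D.
Proof. by move=> GG' [iD D0]; split=> // A /GG'; exact: D0. Qed.

Lemma centered0 G : centered G (fun=> 0).
Proof.
split; first exact: finite_measure_integrable_cst.
by move=> A _; exact: integral0.
Qed.

Lemma centeredD G D D' : G `<=` measurable ->
  centered G D -> centered G D' -> centered G (fun w => D w + D' w).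
Proof.
move=> Gm [iD D0] [iD' D'0]; split.
  have -> : EFin \o (fun w => D w + D' w) = ((EFin \o D) \+ (EFin \o D'))%E.
    by apply/funext => w; rewrite /= EFinD.
  exact: integrableD.
move=> A GA; have mA := Gm _ GA.
under eq_integral do rewrite EFinD.
rewrite integralD_EFin//; [|exact: integrableS iD|exact: integrableS iD'].
by rewrite [X in (X + _)%E]D0// [X in (_ + X)%E]D'0// adde0.
Qed.

Lemma centered_sum G n (D : nat -> Omega -> R) : G `<=` measurable ->
  (forall i, (i < n)%N -> centered G (D i)) ->
  centered G (fun w => \sum_(i < n) D i w).
Proof.
move=> Gm; elim: n => [|n ih] cD.
  by under eq_fun do rewrite big_ord0; exact: centered0.
under eq_fun do rewrite big_ord_recr/=.
by apply: centeredD => //; [apply: ih => i /ltnW; exact: cD|exact: cD].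
Qed.

Lemma integrable_mulr_bounded (C : R) D H : measurable_fun setT H ->
  (forall w, `|H w| <= C) -> P.-integrable setT (EFin \o D) ->
  P.-integrable setT (EFin \o (fun w => H w * D w)).
Proof.
move=> mH HC iD.
have -> : EFin \o (fun w => H w * D w) = ((EFin \o H) \* (EFin \o D))%E.
  by apply/funext => w; rewrite /= EFinM.
apply: integrableMr => //; exists C; split; first exact: num_real.
by move=> x Cx w _ /=; exact: le_trans (HC w) (ltW Cx).
Qed.

Lemma centeredZ G (c : R) D : G `<=` measurable ->
  centered G D -> centered G (fun w => c * D w).
Proof.
move=> Gm [iD D0]; split.
  by apply: (@integrable_mulr_bounded `|c| D (fun=> c)).
move=> A GA; have mA := Gm _ GA.
under eq_integral do rewrite EFinM.
by rewrite integralZl//; [rewrite D0// mule0|exact: integrableS iD].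
Qed.

Lemma centered_indic G B D : sigma_algebra setT G -> G `<=` measurable -> G B ->
  centered G D -> centered G (fun w => \1_B w * D w).
Proof.
move=> sG Gm GB [iD D0]; split.
  apply: (@integrable_mulr_bounded 1) => //.
    by apply: measurable_indic; exact: Gm.
  by move=> w; rewrite indicE; case: (_ \in _); rewrite ?normr1 ?normr0.
move=> A GA; rewrite -(D0 (A `&` B)).
  rewrite integral_mkcondr; apply: eq_integral => w _.
  by rewrite patchE indicE; case: ifPn => _; rewrite ?mul1r ?mul0r.
have [_ _ _ GI] := (sigma_algebraP (fun X _ => @subsetT _ X)).1 sG.
exact: GI.
Qed.

(** Dominated convergence on each event of [G], where the integrals of the approximants form the
    constant sequence 0. *)
Lemma centered_dominated G (D_ : nat -> Omega -> R) D (g : Omega -> \bar R) :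
  G `<=` measurable -> (forall n, centered G (D_ n)) -> measurable_fun setT D ->
  {ae P, forall w, D_ ^~ w @ \oo --> D w} -> P.-integrable setT g ->
  {ae P, forall w, forall n, (`|D_ n w|%:E <= g w)%E} -> centered G D.
Proof.
move=> Gm cD mD D_D ig D_g.
have mD_ n : measurable_fun setT (EFin \o D_ n).
  by have [/measurable_int] := cD n.
have mED : measurable_fun setT (EFin \o D) by exact/measurable_EFinP.
have dc A (mA : measurable A) := @dominated_convergence _ _ _ P A mA
  (fun n => EFin \o D_ n) (EFin \o D) g (fun n => measurable_funTS (mD_ n))
  (measurable_funTS mED).
split.
  have [|//||//] := dc _ measurableT.
    by apply: filterS D_D => w Dw _; apply: cvg_EFin Dw; exact: nearW.
  by apply: filterS D_g => w gw n _; exact: gw.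
move=> A GA; have mA := Gm _ GA.
have [|||_ _] := dc A mA.
- by apply: filterS D_D => w Dw _; apply: cvg_EFin Dw; exact: nearW.
- exact: integrableS ig.
- by apply: filterS D_g => w gw n _; exact: gw.
under eq_fun do rewrite (cD _).2//.
by move=> /(@cvg_unique _ (@ereal_hausdorff R) _ _ _ _); apply; exact: cvg_cst.
Qed.

(** The sum is the floor of [x], counted one integer at a time; when [x] depends on omega it becomes
    a sum of indicators of level sets. *)
Lemma dist_sum_le_nat (N : nat) (x : R) : 0 <= x -> x <= N%:R ->
  `|x - \sum_(k < N) (k.+1%:R <= x)%R%:R| <= 1.
Proof.
move=> x0 xN.
(* The bound [x <= N] does not survive the induction; the alternative that the sum has saturated at
   [N] replaces it. *)
have [h1 h2 h3] : [/\ \sum_(k < N) (k.+1%:R <= x)%R%:R <= x,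
    \sum_(k < N) (k.+1%:R <= x)%R%:R <= N%:R :> R &
    x <= \sum_(k < N) (k.+1%:R <= x)%R%:R + 1 \/
    \sum_(k < N) (k.+1%:R <= x)%R%:R = N%:R :> R].
  elim: N {xN} => [|N [ih1 ih2 ih3]]; first by rewrite big_ord0; split => //; right.
  rewrite big_ord_recr/=; case: (leP N.+1%:R x) => Nx.
    have SN : \sum_(i < N) (i.+1%:R <= x)%R%:R = N%:R :> R.
      case: ih3 => // ih3; apply/eqP; rewrite eq_le ih2/=.
      by rewrite -(lerD2r 1) natr1 (le_trans Nx).
    by rewrite SN natr1; split => //; right.
  rewrite addr0; split => //; first by rewrite (le_trans ih2)// ler_nat.
  by left; case: ih3 => [//|->]; rewrite natr1 ltW.
by rewrite ler_norml; apply/andP; split; case: h3 => h3; lra.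
Qed.

(** Rounding H + C >= 0 down to a multiple of 1/(n+1) gives a finite combination of indicators of
    events of [G] within 1/(n+1) of [H]. The number of levels [N n] suffices because H + C <= 2C. *)
Lemma centered_bounded G (C : R) H D : sigma_algebra setT G ->
  G `<=` measurable -> sub_measurable G H -> (forall w, `|H w| <= C) ->
  centered G D -> centered G (fun w => H w * D w).
Proof.
move=> sG Gm mH HC cD.
pose B n k : set Omega := [set w | k.+1%:R <= n.+1%:R * (H w + C)].
pose N n : nat := Num.bound (n.+1%:R * (C + C)).
pose S n w := n.+1%:R^-1 * \sum_(k < N n) \1_(B n k) w - C.
have C0 : 0 <= C by apply: le_trans (HC point).
have HC0 w : 0 <= H w + C by have := HC w; rewrite ler_norml; lra.
have HCC w : H w + C <= C + C by have := HC w; rewrite ler_norml; lra.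
have GB n k : G (B n k).
  apply: mH; exists `[k.+1%:R / n.+1%:R - C, +oo[%classic; first exact: measurable_itv.
  rewrite setTI; apply/seteqP; split=> w; rewrite /B /= in_itv/= andbT.
    by rewrite lerBlDr ler_pdivrMr// mulrC.
  by rewrite lerBlDr ler_pdivrMr// mulrC.
have mHm : measurable_fun setT H.
  by move=> _ Y mY; apply: Gm; apply: mH; exists Y.
have SH n w : `|S n w - H w| <= n.+1%:R^-1.
  have -> : S n w - H w = n.+1%:R^-1 *
      (\sum_(k < N n) \1_(B n k) w - n.+1%:R * (H w + C)).
    by rewrite /S mulrBr mulrA mulVf ?pnatr_eq0// mul1r; ring.
  rewrite normrM ger0_norm ?invr_ge0// -[leRHS]mulr1 ler_wpM2l ?invr_ge0//.
  rewrite distrC.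
  rewrite (eq_bigr (fun k : 'I_(N n) =>
    (k.+1%:R <= n.+1%:R * (H w + C))%R%:R)); last first.
    by move=> k _; rewrite indicE mem_setE.
  apply: dist_sum_le_nat; first by rewrite mulr_ge0.
  apply: (@le_trans _ _ (n.+1%:R * (C + C))); first by rewrite ler_wpM2l.
  by rewrite ltW// archi_boundP// mulr_ge0// addr_ge0.
(* Since 1/(n+1) <= 1, the rounded functions are bounded by C + 1. *)
apply: (@centered_dominated _ (fun n w => S n w * D w) _
    (fun w => ((C + 1) * `|D w|)%:E)) => //.
- move=> n; rewrite /S.
  have -> : (fun w => (n.+1%:R^-1 * \sum_(k < N n) \1_(B n k) w - C) * D w) =
      (fun w => n.+1%:R^-1 * (\sum_(k < N n) \1_(B n k) w * D w) + (- C) * D w).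
    by apply/funext => w; rewrite mulrDl -mulrA mulr_suml.
  apply: centeredD => //; last exact: centeredZ.
  apply: centeredZ => //.
  apply: (@centered_sum _ _ (fun k w => \1_(B n k) w * D w)) => // i _.
  exact: centered_indic.
- apply: measurable_funM => //; apply/measurable_EFinP.
  by have [/measurable_int] := cD.
- apply: aeW => w; apply: cvgMr_tmp.
  have := @cvg_harmonic R; rewrite /harmonic => h0.
  apply/cvgrPdist_le => e e0; near=> n.
  rewrite distrC (le_trans (SH n w))//.
  near: n; have /cvgrPdist_le/(_ _ e0) := h0.
  by apply: filterS => n; rewrite sub0r normrN ger0_norm ?invr_ge0.
- have [iD _] := cD.
  have := @integrable_mulr_bounded (C + 1) (fun w => `|D w|) (fun=> C + 1).
  apply => //; last exact: integrable_norm.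
  by move=> _; rewrite ger0_norm ?addr_ge0.
- apply: aeW => w n; rewrite lee_fin normrM ler_wpM2r//.
  rewrite -[S n w](subrK (H w)) (le_trans (ler_normD _ _))// addrC lerD//.
  by rewrite (le_trans (SH n w))// invf_le1// ler1n.
Unshelve. all: by end_near. Qed.

End null_conditional_expectation.

(** * Brownian increments and the Ito integral *)

Section augmentation.
Context {R : realType} {d : measure_display} {Omega : measurableType d}.
Variable P : probability Omega R.
Implicit Types (G : set (set Omega)) (A B : set Omega).

(** The sets that differ from some member of [<<s G >>] by a null set form a sigma-algebra
    containing all the generators. *)
Lemma augmented_sigma_algebraP G A :
  <<s G `|` [set N | P.-negligible N] >> A ->
  exists2 B, <<s G >> B & P.-negligible ((A `\` B) `|` (B `\` A)).
Proof.
move=> /(_ [set A | exists2 B, <<s G >> B &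
  P.-negligible ((A `\` B) `|` (B `\` A))]); apply.
split => [|X [GX|NX]] /=; last 2 first.
- exists X; first exact: sub_sigma_algebra.
  by rewrite setDv setU0; exact: negligible_set0.
- exists set0; first exact: sigma_algebra0.
  by rewrite setD0 set0D setU0.
split=> /=.
- exists set0; first exact: sigma_algebra0.
  by rewrite setDv setU0; exact: negligible_set0.
- move=> X [B GB NB]; exists (~` B); first exact: sigma_algebraC.
  apply: negligibleS NB => w [[[_ Xw] Bw]|[Bw Xw]]; [right|left]; split => //.
    exact: contrapT.
  by apply: contrapT => ?; apply: Xw.
- move=> F FP; have [B_ B_P] := choice (fun i => let: ex_intro2 B GB NB := FP i in
    ex_intro (fun B => <<s G >> B /\ P.-negligible ((F i `\` B) `|` (B `\` F i)))
      B (conj GB NB)).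
  exists (\bigcup_i B_ i).
    by apply: sigma_algebra_bigcup => i; have [] := B_P i.
  apply: (@negligibleS _ _ _ _ (\bigcup_i ((F i `\` B_ i) `|` (B_ i `\` F i)))).
    move=> w [[[i _ Fi] nB]|[[i _ Bi] nF]]; exists i => //; [left|right];
      split => // ?; [apply: nB|apply: nF]; by exists i.
  by apply: negligible_bigcup => i; have [] := B_P i.
Qed.

Lemma integral_symdiff_negligible (D : Omega -> R) A B :
  P.-integrable setT (EFin \o D) -> measurable A -> measurable B ->
  P.-negligible ((A `\` B) `|` (B `\` A)) ->
  (\int[P]_(w in A) (D w)%:E = \int[P]_(w in B) (D w)%:E)%E.
Proof.
move=> /(measurable_int P) mD mA mB AB.
rewrite [LHS]integral_mkcond [RHS]integral_mkcond.
have mDr C : measurable C -> measurable_fun setT ((EFin \o D) \_ C).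
  by move=> mC; apply/(measurable_restrictT _ mC).1; exact: measurable_funTS.
apply: ae_eq_integral; [by []|exact: mDr|exact: mDr|].
apply: negligibleS AB => w /= /not_implyP[_]; rewrite !patchE.
have [Aw|nAw] := pselect (A w); have [Bw|nBw] := pselect (B w).
- by rewrite !mem_set.
- by left.
- by right.
- by rewrite !memNset.
Qed.

End augmentation.

Section brownian_increments.
Context {R : realType} {d : measure_display} {Omega : measurableType d}.
Variables (P : probability Omega R) (W : R -> Omega -> R) (T : R).
Hypothesis P_complete : measure_is_complete P.
Hypothesis bm : standard_brownian_motion P W T.

Local Notation F := (brownian_filtration P W).

Lemma events_upto_sub s t : s <= t -> events_upto W s `<=` events_upto W t.
Proof.
move=> st A [r /= rs WA]; exists r => //=.
by move: rs; rewrite !in_itv/= => /andP[-> /le_trans->].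
Qed.

Lemma events_upto_measurable t : t <= T -> <<s events_upto W t >> `<=` measurable.
Proof.
move=> tT A; apply; split; first exact: sigma_algebra_measurable.
move=> X [s /=]; rewrite in_itv/= => /andP[s0 st] [B mB <-].
by apply: (bm_measurable bm) => //; rewrite s0 (le_trans st).
Qed.

Lemma brownian_filtration_sigma_algebra t : sigma_algebra setT (F t).
Proof. exact: smallest_sigma_algebra. Qed.

Lemma brownian_filtration_sub s t : s <= t -> F s `<=` F t.
Proof. by move=> st; apply: sub_sigma_algebra2; apply: setSU; exact: events_upto_sub. Qed.

Lemma negligible_brownian_filtration t N : P.-negligible N -> F t N.
Proof. by move=> NN; apply: sub_sigma_algebra; right. Qed.

Lemma brownian_filtration_measurable t : t <= T -> F t `<=` measurable.
Proof.
move=> tT A; apply; split; first exact: sigma_algebra_measurable.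
move=> X [uX|/P_complete//].
by apply: (events_upto_measurable tT); exact: sub_sigma_algebra.
Qed.

Let measurable_increment (r q : R) : 0 <= r -> r < q -> q <= T ->
  measurable_fun setT (fun w => W q w - W r w).
Proof.
move=> r0 rq qT; apply: measurable_funB; apply: (bm_measurable bm).
  by rewrite (le_trans r0 (ltW rq)).
by rewrite r0 (le_trans (ltW rq)).
Qed.

(** By independence, the law of the increment under P restricted to [A] is P(A) times the Gaussian
    law. *)
Lemma integral_increment (r q : R) A (h : R -> R) : 0 <= r -> r < q -> q <= T ->
  <<s events_upto W r >> A -> (forall x, 0 <= h x) -> measurable_fun setT h ->
  (\int[P]_(w in A) (h (W q w - W r w))%:E =
   P A * \int[normal_prob 0 (Num.sqrt (q - r))]_x (h x)%:E)%E.
Proof.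
move=> r0 rq qT rA h0 mh.
have mA : measurable A.
  by apply: events_upto_measurable rA; exact: le_trans (ltW rq) qT.
have mD := measurable_increment r0 rq qT.
have mhD : measurable_fun setT (fun w => (h (W q w - W r w))%:E).
  by apply/measurable_EFinP; exact: measurableT_comp mh mD.
have -> : (\int[P]_(w in A) (h (W q w - W r w))%:E =
           \int[mrestr P mA]_w (h (W q w - W r w))%:E)%E.
  (* Under the measure restricted to [A] the complement of [A] is null, so the integral over [A] is
     one over the whole space. *)
  rewrite -(setUv A) ge0_integral_setU//; last 4 first.
  - exact: measurableC.
  - exact: measurable_funTS.
  - by move=> w _; rewrite lee_fin.
  - by rewrite disj_set2E setICr.
  rewrite [X in (_ = _ + X)%E](_ : _ = 0%E); last first.
    apply: null_set_integral; first exact: measurableC.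
      exact: measurable_funTS.
    by rewrite /= /mrestr setICl measure0.
  rewrite adde0; apply: eq_measure_integral => B mB BA.
  by rewrite /= /mrestr setIidl.
pose PA : {nonneg R} := NngNum (fine_ge0 (measure_ge0 P A)).
have PAE : PA%:num%:E = P A by rewrite /= fineK// fin_num_measure.
pose S := measurableTypeR R.
pose phi : Omega -> S := fun w => W q w - W r w.
have mphi : measurable_fun setT phi by exact: mD.
have mhS : measurable_fun [set: S] (fun x : S => (h x)%:E).
  exact/measurable_EFinP.
transitivity (\int[pushforward (mrestr P mA) phi]_x (h x)%:E)%E.
  rewrite ge0_integral_pushforward//.
  by move=> x _; rewrite lee_fin.
rewrite -PAE -ge0_integral_mscale//; last by move=> x _; rewrite lee_fin.
unshelve epose (pm := pushforward (mrestr P mA) phi : {measure set S -> \bar R}).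
  exact: mphi.
apply: (@eq_measure_integral _ _ R setT
  [the measure _ _ of mscale PA (normal_prob 0 (Num.sqrt (q - r)))] pm) => B mB _.
transitivity (P (A `&` (W q \- W r)%R @^-1` B)); first by rewrite setIC.
rewrite (bm_independent bm r0 rq qT rA mB) -PAE.
by rewrite (bm_increment bm r0 rq qT mB).
Qed.

(** On an event of the unaugmented past, the positive and negative parts of the increment have equal
    finite integrals, by independence and symmetry. *)
Lemma centered_increment (r q : R) : 0 <= r -> r < q -> q <= T ->
  centered P (F r) (fun w => W q w - W r w).
Proof.
move=> r0 rq qT; have mD := measurable_increment r0 rq qT.
have s0 : 0 < Num.sqrt (q - r) by rewrite sqrtr_gt0 subr_gt0.
have rT : r <= T by exact: le_trans (ltW rq) qT.
have NT := normal_prob_abs_lty s0.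
have iD : P.-integrable setT (EFin \o (fun w => W q w - W r w)).
  apply/integrableP; split; first exact/measurable_EFinP.
  under eq_integral do rewrite abse_EFin.
  rewrite (@integral_increment r q setT (fun x => `|x|))// ?probability_setT ?mul1e//.
  by have := sigma_algebraC (@sigma_algebra0 _ setT (events_upto W r)); rewrite setC0.
split=> // A /augmented_sigma_algebraP[B rB AB].
have mB := events_upto_measurable rT rB.
rewrite (@integral_symdiff_negligible _ _ _ P (fun w => W q w - W r w) A B)//; last first.
  (* Completeness makes [A] measurable, as [B] modified on two null sets. *)
  rewrite (_ : A = (B `\` (B `\` A)) `|` (A `\` B)).
    apply: measurableU; first apply: measurableD => //.
      by apply: P_complete; apply: negligibleS AB => w; right.
    by apply: P_complete; apply: negligibleS AB => w; left.
  by rewrite setDD setIC setUIDK.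
have mp : measurable_fun [set: R] (fun x : R => Num.max x 0).
  exact: measurable_maxr.
have mn : measurable_fun [set: R] (fun x : R => Num.max (- x) 0).
  by apply: measurable_maxr => //; exact: oppr_measurable.
rewrite integralE/=.
rewrite [X in (X - _)%E](_ : _ =
    \int[P]_(w in B) (Num.max (W q w - W r w)%R 0)%:E)%E; last first.
  by apply: eq_integral => w _; rewrite funeposE EFin_max.
rewrite [X in (_ - X)%E](_ : _ =
    \int[P]_(w in B) (Num.max (- (W q w - W r w))%R 0)%:E)%E; last first.
  by apply: eq_integral => w _; rewrite funenegE EFin_max.
rewrite (@integral_increment r q B (fun x => Num.max x 0))//; last first.
  by move=> x; rewrite le_max lexx orbT.
rewrite (@integral_increment r q B (fun x => Num.max (- x) 0))//; last first.
  by move=> x; rewrite le_max lexx orbT.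
rewrite -normal_prob_pos_neg// subee// fin_numM ?fin_num_measure//.
rewrite ge0_fin_numE; last by apply: integral_ge0 => x _; rewrite lee_fin le_max lexx orbT.
apply: le_lt_trans NT; apply: ge0_le_integral => //.
- by move=> x _; rewrite lee_fin le_max lexx orbT.
- exact/measurable_EFinP.
- by apply/measurable_EFinP; exact: normr_measurable.
- move=> x _; rewrite lee_fin; case: (leP x 0) => _; first exact: normr_ge0.
  exact: ler_norm.
Qed.

End brownian_increments.

Section ito_integral_martingale.
Context {R : realType} {d : measure_display} {Omega : measurableType d}.
Variables (P : probability Omega R) (W : R -> Omega -> R) (T : R).
Hypothesis P_complete : measure_is_complete P.
Hypothesis bm : standard_brownian_motion P W T.

Local Notation F := (brownian_filtration P W).

Lemma sub_measurable_fun (G : set (set Omega)) d' (E : measurableType d')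
    (V : Omega -> E) :
  G `<=` measurable -> sub_measurable G V -> measurable_fun setT V.
Proof. by move=> Gm GV _ B mB; apply: Gm; apply: GV; exists B. Qed.

Lemma sub_measurableS (G G' : set (set Omega)) d' (E : measurableType d')
    (V : Omega -> E) :
  G `<=` G' -> sub_measurable G V -> sub_measurable G' V.
Proof. by move=> GG' GV; exact: subset_trans GG'. Qed.

(** On an event of [G] the integral of [D] equals that of D - D', hence is at most [e] in absolute
    value. Integrability of [D] comes from the case e = 1. *)
Lemma centered_approx (G : set (set Omega)) (D : Omega -> R) :
  G `<=` measurable -> measurable_fun setT D ->
  (forall e : R, 0 < e -> exists2 D', centered P G D' &
    (\int[P]_w `|D w - D' w|%:E <= e%:E)%E) ->
  centered P G D.
Proof.
move=> Gm mD DD'.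
have iB D' (e : R) : centered P G D' -> (\int[P]_w `|D w - D' w|%:E <= e%:E)%E ->
    P.-integrable setT (EFin \o (fun w => D w - D' w)).
  move=> [/(measurable_int P)/measurable_EFinP mD' _] le_e; apply/integrableP; split.
    by apply/measurable_EFinP; exact: measurable_funB.
  by under eq_integral do rewrite abse_EFin; exact: le_lt_trans le_e (ltry _).
have iD : P.-integrable setT (EFin \o D).
  have [D' cD' D'1] := DD' _ ltr01.
  have -> : EFin \o D = ((EFin \o (fun w => D w - D' w)%R) \+ (EFin \o D'))%E.
    by apply/funext => w; rewrite /= -EFinD subrK.
  by apply: integrableD => //; [exact: iB cD' D'1|case: cD'].
split=> // A GA; have mA := Gm _ GA.
apply/eqP; rewrite -abse_eq0 eq_le abse_ge0 andbT.
apply/lee_addgt0Pr => e e0; rewrite add0e.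
have [D' cD' le_e] := DD' _ e0; have iDD' := iB _ _ cD' le_e.
rewrite (_ : \int[P]_(w in A) _ = \int[P]_(w in A) (D w - D' w)%:E)%E; last first.
  under [RHS]eq_integral do rewrite EFinB.
  have [iD' D'0] := cD'.
  rewrite integralB_EFin//; [|exact: integrableS iD|exact: integrableS iD'].
  by rewrite (D'0 _ GA) sube0.
have mDD' := measurable_int P iDD'.
apply: le_trans le_e; apply: (@le_trans _ _ (\int[P]_(w in A) `|D w - D' w|%:E)%E).
  by apply: le_abse_integral => //; exact: measurable_funTS.
apply: ge0_subset_integral => //.
exact: (measurableT_comp (@abse_measurable R setT) mDD').
Qed.

(** Pointwise |D| <= e + |D|^2 / e; on a probability space this stands in for the Cauchy-Schwarz
    inequality at the cost of a factor 2. *)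
Lemma integral_norm_le_sqr (D : Omega -> R) (e : R) : measurable_fun setT D ->
  0 < e -> (\int[P]_w (`|D w| ^+ 2)%:E <= (e ^+ 2)%:E)%E ->
  (\int[P]_w `|D w|%:E <= (e + e)%:E)%E.
Proof.
move=> mD e0 De.
have mD2 : measurable_fun setT (fun w => (`|D w| ^+ 2)%:E).
  by apply/measurable_EFinP/measurable_funX; exact: measurableT_comp.
have ie0 : 0 <= e^-1 by rewrite invr_ge0 ltW.
apply: (@le_trans _ _ (\int[P]_w (e%:E + (e^-1)%:E * (`|D w| ^+ 2)%:E))%E).
  apply: ge0_le_integral => //.
  - by apply/measurable_EFinP; exact: measurableT_comp.
  - by apply: emeasurable_funD => //; exact: measurable_funeM.
  move=> w _; rewrite -EFinM -EFinD lee_fin.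
  suff : 0 <= e^-1 * (`|D w| - e) ^+ 2 + `|D w|.
    suff -> : e^-1 * (`|D w| - e) ^+ 2 + `|D w| = e + e^-1 * `|D w| ^+ 2 - `|D w|.
      by rewrite subr_ge0.
    by field; rewrite gt_eqF.
  by rewrite addr_ge0// mulr_ge0// sqr_ge0.
rewrite ge0_integralD//; last 3 first.
- by move=> w _; rewrite lee_fin ltW.
- by move=> w _; rewrite mule_ge0// lee_fin.
- exact: measurable_funeM.
rewrite integral_cst// [X in (_ * X + _)%E](@probability_setT _ _ _ P) mule1.
rewrite ge0_integralZl//.
rewrite EFinD leeD2l//.
rewrite (le_trans (lee_wpmul2l _ De)) ?lee_fin//.
by rewrite expr2 mulKf// gt_eqF.
Qed.

Variable phi : simple_process (R := R) (Omega := Omega).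
Hypothesis phi_ok : simple_process_ok T F phi.

Lemma simple_process_time_ge0 i : (i <= sp_size phi)%N -> 0 <= sp_time phi i.
Proof.
elim: i => [|i ih] ile; first by rewrite (sp_start phi_ok).
exact: le_trans (ih (ltnW ile)) (sp_nondecreasing phi_ok ile).
Qed.

Lemma simple_process_time_le i : (i <= sp_size phi)%N -> sp_time phi i <= T.
Proof.
move=> /subnK; move: (sp_size phi - i)%N => k.
elim: k i => [|k ih] i; first by rewrite add0n => ->; rewrite (sp_end phi_ok).
rewrite addSnnS => ik; apply: le_trans (ih _ ik).
by apply: (sp_nondecreasing phi_ok); rewrite -ik ltn_addl.
Qed.

Lemma measurable_simple_integral u : 0 <= u <= T ->
  measurable_fun setT (simple_integral W phi u).
Proof.
move=> /andP[u0 uT]; apply: measurable_sum => i.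
have i1 := simple_process_time_ge0 (ltn_ord i).
have i0 := simple_process_time_ge0 (ltnW (ltn_ord i)).
have i0T := simple_process_time_le (ltnW (ltn_ord i)).
apply: measurable_funM.
  apply: (sub_measurable_fun (brownian_filtration_measurable P_complete bm i0T)).
  exact: (sp_measurable phi_ok).
by apply: measurable_funB; apply: (bm_measurable bm);
  rewrite le_min ge_min uT ?i1 ?i0 ?u0 ?orbT.
Qed.

(** Each step contributes its coefficient times the increment of W over the part of the step after
    [u]. This is nothing if the step ends by [u]; otherwise the increment starts at the later of [u]
    and the start of the step, a time at which the coefficient is known. *)
Lemma centered_simple_integral u : 0 <= u <= T ->
  centered P (F u) (fun w => simple_integral W phi T w - simple_integral W phi u w).
Proof.
move=> /andP[u0 uT].
have Fm s : s <= T -> F s `<=` measurable.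
  exact: (brownian_filtration_measurable P_complete bm).
pose D i w := sp_coef phi i w * ((W (sp_time phi i.+1) w - W (sp_time phi i) w) -
  (W (Num.min (sp_time phi i.+1) u) w - W (Num.min (sp_time phi i) u) w)).
have -> : (fun w => simple_integral W phi T w - simple_integral W phi u w) =
    (fun w => \sum_(i < sp_size phi) D i w).
  apply/funext => w; rewrite /simple_integral -sumrB; apply: eq_bigr => i _.
  rewrite /D (min_idPl (simple_process_time_le (ltn_ord i))).
  by rewrite (min_idPl (simple_process_time_le (ltnW (ltn_ord i)))) -mulrBr.
apply: centered_sum; first exact: Fm.
move=> i ilt; rewrite /D.
have pp := sp_nondecreasing phi_ok ilt.
have p1T := simple_process_time_le ilt.
have p0 := simple_process_time_ge0 (ltnW ilt).
have mh := sp_measurable phi_ok ilt.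
have [C hC] := sp_bounded phi_ok ilt.
move: pp p1T p0 mh; set p := sp_time phi i; set q := sp_time phi i.+1.
move=> pq qT p0 mh.
(* The increment is centered given F r, where the coefficient can be taken out; restricting to the
   smaller F u preserves this. *)
have cH r s : 0 <= r -> r < s -> s <= T -> p <= r -> u <= r ->
    centered P (F u) (fun w => sp_coef phi i w * (W s w - W r w)).
  move=> r0 rs sT pr ur; apply: (@sub_centered _ _ _ P (F r)).
    exact: brownian_filtration_sub.
  have rT : r <= T by exact: le_trans (ltW rs) sT.
  apply: (@centered_bounded _ _ _ P (F r) C) => //.
  - exact: brownian_filtration_sigma_algebra.
  - exact: Fm.
  - by apply: sub_measurableS mh; exact: brownian_filtration_sub.
  - exact: (centered_increment P_complete bm).
have [qu|uq] := leP q u.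
  rewrite (min_idPl (le_trans pq qu)).
  by under eq_fun do rewrite subrr mulr0; exact: centered0.
have [pu|up] := leP p u.
  under eq_fun do rewrite opprB addrA subrK.
  exact: cH.
under eq_fun do rewrite subrr subr0.
(* A simple process may repeat a time, and such a step has zero increment. *)
move: pq; rewrite le_eqVlt => /predU1P[->|pq]; last by apply: cH => //; exact: ltW.
by under eq_fun do rewrite subrr mulr0; exact: centered0.
Qed.

End ito_integral_martingale.

Lemma centered_ito_integral {R : realType} {d : measure_display}
    {Omega : measurableType d} (P : probability Omega R) (W : R -> Omega -> R)
    (T : R) (v M : R -> Omega -> R) :
  measure_is_complete P -> standard_brownian_motion P W T ->
  is_ito_integral P T (brownian_filtration P W) W v M ->
  forall u, 0 <= u <= T ->
  centered P (brownian_filtration P W u) (fun w => M T w - M u w).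
Proof.
move=> cP bm [aM _ [phi [phi_ok _ phiM]]] u uT; have /andP[u0 u_le_T] := uT.
have TT : 0 <= T <= T by rewrite (le_trans u0 u_le_T) lexx.
have mM s : 0 <= s <= T -> measurable_fun setT (M s).
  move=> sT; apply: sub_measurable_fun (aM s sT).
  by apply: (brownian_filtration_measurable cP bm); case/andP: sT.
have mI n s : 0 <= s <= T -> measurable_fun setT (simple_integral W (phi n) s).
  exact: (measurable_simple_integral cP bm).
apply: centered_approx.
- exact: (brownian_filtration_measurable cP bm).
- by apply: measurable_funB; exact: mM.
(* An L^2 error of e/4 gives an L^1 error of e/2, at time T and at time u, hence e in total. *)
move=> e e0; have e40 : 0 < e / 4 by rewrite divr_gt0.
have small s : 0 <= s <= T -> \forall n \near \oo,
    (\int[P]_w (`|M s w - simple_integral W (phi n) s w| ^+ 2)%:E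
       <= ((e / 4) ^+ 2)%:E)%E.
  move=> sT; have := phiM s sT => /fine_cvgP[fin].
  move=> /cvgrPdist_le/(_ ((e / 4) ^+ 2)); rewrite exprn_gt0// => /(_ isT).
  apply: filterS2 fin => n fn; rewrite sub0r normrN => le_n.
  by rewrite -(fineK fn) lee_fin (le_trans (ler_norm _)).
have [n [nT nu]] : exists n,
    (\int[P]_w (`|M T w - simple_integral W (phi n) T w| ^+ 2)%:E
       <= ((e / 4) ^+ 2)%:E)%E /\
    (\int[P]_w (`|M u w - simple_integral W (phi n) u w| ^+ 2)%:E
       <= ((e / 4) ^+ 2)%:E)%E.
  by near \oo => n; exists n; split; near: n; exact: small.
exists (fun w => simple_integral W (phi n) T w - simple_integral W (phi n) u w).
  exact: (centered_simple_integral cP bm).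
have mB s : 0 <= s <= T ->
    measurable_fun setT (fun w => M s w - simple_integral W (phi n) s w).
  by move=> sT; apply: measurable_funB; [exact: mM|exact: mI].
have L1 s (sT : 0 <= s <= T) := integral_norm_le_sqr (P := P) (mB s sT) e40.
have mN s : 0 <= s <= T -> measurable_fun setT
    (fun w => `|M s w - simple_integral W (phi n) s w|%:E).
  by move=> sT; apply/measurable_EFinP; apply: measurableT_comp => //; exact: mB.
apply: (@le_trans _ _ (\int[P]_w (`|M T w - simple_integral W (phi n) T w|%:E +
    `|M u w - simple_integral W (phi n) u w|%:E))%E).
  apply: ge0_le_integral => //.
  - apply/measurable_EFinP; apply: measurableT_comp => //.
    by apply: measurable_funB; apply: measurable_funB; (exact: mM || exact: mI).
  - by apply: emeasurable_funD; exact: mN.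
  - move=> w _; rewrite -EFinD lee_fin.
    rewrite [X in `|X|](_ : _ = (M T w - simple_integral W (phi n) T w) -
      (M u w - simple_integral W (phi n) u w)); last by ring.
    exact: ler_normB.
rewrite ge0_integralD//; [|exact: mN|exact: mN].
rewrite (le_trans (leeD (L1 T TT nT) (L1 u uT nu)))// -EFinD lee_fin; lra.
Unshelve. all: by end_near. Qed.

(** * Grids, stopping times and first contact *)

Section grids.
Context {R : realType}.
Implicit Types (a b s : R) (v h : R -> R).

(** [n] is one less than the number of steps, so that every [n] gives a subdivision; the points for
    all [n] together are countable and dense in [a, b]. *)
Definition grid a b (n k : nat) : R := a + (b - a) * (k%:R / n.+1%:R).

Lemma grid0 a b n : grid a b n 0 = a.
Proof. by rewrite /grid mul0r mulr0 addr0. Qed.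

Lemma grid_last a b n : grid a b n n.+1 = b.
Proof. by rewrite /grid divff ?pnatr_eq0// mulr1 addrC subrK. Qed.

Lemma gridS a b n k : grid a b n k.+1 = grid a b n k + (b - a) / n.+1%:R.
Proof. by rewrite /grid -natr1 (mulrDl k%:R) mulrDr addrA mul1r. Qed.

Lemma grid_le a b n k : a <= b -> grid a b n k <= grid a b n k.+1.
Proof. by move=> ab; rewrite gridS lerDl divr_ge0// subr_ge0. Qed.

Lemma grid_in a b n k : a <= b -> (k <= n.+1)%N -> a <= grid a b n k <= b.
Proof.
move=> ab kn; rewrite /grid lerDl mulr_ge0 ?subr_ge0 ?divr_ge0//= -lerBrDl.
by rewrite ler_piMr ?subr_ge0// ler_pdivrMr// mul1r ler_nat.
Qed.

(** Along a monotone [v] the condition [v k < s] selects an initial segment, so the sum telescopes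
    up to the first index with [s <= v j]. The last clause expresses that [j] is the first one. *)
Lemma telescope_until (v : nat -> R) h s n : {homo v : i j / (i <= j)%N >-> i <= j} ->
  v 0 <= s -> s <= v n ->
  exists j, [/\ (j <= n)%N,
    \sum_(k < n) (v k < s)%R%:R * (h (v k.+1) - h (v k)) = h (v j) - h (v 0),
    s <= v j & j = 0 \/ exists2 i, j = i.+1 & v i < s].
Proof.
move=> vmono v0s; elim: n => [s0|n ih sn].
  by exists 0; split; [by []|by rewrite big_ord0 subrr| |left].
rewrite big_ord_recr/=; case: (leP s (v n)) => svn.
  have [j [jn E sj Q]] := ih svn; exists j; split => //; first exact: leqW.
  by rewrite E mul0r addr0.
exists n.+1; split => //; last by right; exists n.
rewrite (eq_bigr (fun k : 'I_n => h (v k.+1) - h (v k))); last first.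
  by move=> k _; rewrite (le_lt_trans (vmono _ _ (ltnW (ltn_ord k))))// mul1r.
by rewrite -(big_mkord xpredT (fun k => h (v k.+1) - h (v k)))
  telescope_sumr// mul1r addrC subrKA.
Qed.

Lemma grid_telescope a b h s n : a <= s -> s <= b ->
  exists j, [/\ (j <= n.+1)%N,
    \sum_(k < n.+1) (grid a b n k < s)%R%:R * (h (grid a b n k.+1) - h (grid a b n k))
      = h (grid a b n j) - h a,
    s <= grid a b n j & grid a b n j - s <= (b - a) / n.+1%:R].
Proof.
move=> as_ sb; have ab := le_trans as_ sb.
have [|||j [jn E sj Q]] := @telescope_until (grid a b n) h s n.+1.
- apply: homo_leq => //; first exact: le_trans.
  by move=> k; exact: grid_le.
- by rewrite grid0.
- by rewrite grid_last.
exists j; split => //; first by rewrite E grid0.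
case: Q => [j0|[i ji vis]].
  rewrite j0 grid0 (le_trans (y := 0)) ?subr_le0//.
  by rewrite divr_ge0// subr_ge0.
by rewrite ji gridS addrAC gerDr subr_le0 ltW.
Qed.

Lemma near_grid_step a b (e : R) : 0 < e -> \forall n \near \oo, (b - a) / n.+1%:R < e.
Proof.
move=> e0; have : (b - a) * n.+1%:R^-1 @[n --> \oo] --> (b - a) * 0.
  by apply: cvgMl_tmp; exact: cvg_harmonic.
rewrite mulr0 => /cvgrPdist_lt/(_ _ e0); apply: filterS => n.
by rewrite sub0r normrN; exact: le_lt_trans (ler_norm _).
Qed.

Lemma within_continuousP a b h : {within `[a, b], continuous h} ->
  forall s, a <= s <= b -> forall e : R, 0 < e -> exists2 e', 0 < e' &
  forall x, a <= x <= b -> `|x - s| < e' -> `|h x - h s| < e.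
Proof.
move=> /subspace_continuousP hc s sab e e0.
have /hc/cvgrPdist_lt/(_ _ e0) : `[a, b]%classic s by rewrite /= in_itv.
rewrite near_withinE => /nbhs_ballP[e' /= e'0 H]; exists e' => // x xab xs.
rewrite distrC; apply: H; last by rewrite /= in_itv.
by rewrite /ball/= distrC.
Qed.

Lemma grid_telescope_cvg a b h s : {within `[a, b], continuous h} -> a <= s <= b ->
  (fun n => \sum_(k < n.+1) (grid a b n k < s)%R%:R *
     (h (grid a b n k.+1) - h (grid a b n k))) @ \oo --> h s - h a.
Proof.
move=> hc sab; apply/cvgrPdist_lt => e e0.
have [e' e'0 H] := within_continuousP hc sab e0.
have /andP[as_ sb] := sab; have ab := le_trans as_ sb.
have := near_grid_step a b e'0; apply: filterS => n ne.
have [j [jn -> sj js]] := grid_telescope h n as_ sb.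
rewrite (_ : _ - _ = - (h (grid a b n j) - h s)); last by ring.
rewrite normrN H ?grid_in//.
by rewrite ger0_norm ?subr_ge0// (le_lt_trans js).
Qed.

Lemma grid_dense a b s (e : R) : a <= s <= b -> 0 < e ->
  exists n k, (k <= n.+1)%N /\ `|grid a b n k - s| < e.
Proof.
move=> /andP[as_ sb] e0; have [n] := filter_ex (near_grid_step a b e0).
have [j [jn _ sj js]] := grid_telescope id n as_ sb.
move=> ne; exists n, j; split => //.
by rewrite ger0_norm ?subr_ge0// (le_lt_trans js).
Qed.

(** Serves to turn almost sure inequalities at each grid time into one inequality along almost every
    whole path. *)
Lemma within_continuous_ge0 a b h : {within `[a, b], continuous h} ->
  (forall n k, (k <= n.+1)%N -> 0 <= h (grid a b n k)) ->
  forall s, a <= s <= b -> 0 <= h s.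
Proof.
move=> hc h0 s sab; rewrite leNgt; apply/negP => hs.
have ab : a <= b by case/andP: sab; exact: le_trans.
have [|e e0 H] := within_continuousP hc sab (e := - h s); first by rewrite oppr_gt0.
have [n [k [kn /H]]] := grid_dense sab e0.
rewrite grid_in// => /(_ isT); rewrite ltr_norml => /andP[_]; have := h0 n k kn; lra.
Qed.

End grids.

(** * Stopping times and optional stopping along grids *)

Section stopping_times.
Context {R : realType} {d : measure_display} {Omega : measurableType d}.
Variables (P : probability Omega R) (T : R) (F : R -> set (set Omega)).
Hypothesis P_complete : measure_is_complete P.
Hypothesis F_sigma : forall u, sigma_algebra setT (F u).
Hypothesis F_sub : forall s u, s <= u -> F s `<=` F u.
Hypothesis F_negligible : forall u N, P.-negligible N -> F u N.
Hypothesis F_measurable : forall u, u <= T -> F u `<=` measurable.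

(** Taking [G] itself as the sigma-algebra of Omega makes the closure properties of measurable
    functions available for [G]. *)
Lemma sub_measurable_sigmaType (G : set (set Omega)) d' (E : measurableType d')
    (V : Omega -> E) : sigma_algebra setT G -> sub_measurable G V ->
  measurable_fun [set: g_sigma_algebraType G] V.
Proof.
move=> sG GV _ B mB.
have -> : (measurable : set (set (g_sigma_algebraType G))) = G.
  exact: measurable_g_measurableTypeE.
by apply: GV; exists B.
Qed.

Lemma filtration_measurableE u :
  (measurable : set (set (g_sigma_algebraType (F u)))) = F u.
Proof. exact: measurable_g_measurableTypeE. Qed.

Lemma filtration_negligible u A B : F u A ->
  P.-negligible ((A `\` B) `|` (B `\` A)) -> F u B.
Proof.
rewrite -filtration_measurableE => FA AB.
rewrite (_ : B = (A `\` (A `\` B)) `|` (B `\` A)); last by rewrite setDD setIC setUIDK.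
by apply: measurableU; first apply: measurableD => //;
  rewrite filtration_measurableE; apply: F_negligible; apply: negligibleS AB => w;
  [left|right].
Qed.

(** [V] agrees almost everywhere with a limsup of measurable functions, and P is complete. *)
Lemma ae_cvg_measurable (V_ : nat -> Omega -> R) (V : Omega -> R) :
  (forall n, measurable_fun setT (V_ n)) ->
  {ae P, forall w, V_ ^~ w @ \oo --> V w} -> measurable_fun setT V.
Proof.
move=> mV_ V_V; apply/measurable_EFinP.
pose U w := limn_esup (fun n => (V_ n w)%:E).
have mU : measurable_fun setT U.
  by apply: measurable_fun_limn_esup => n; exact/measurable_EFinP.
apply: (ae_measurable_fun P_complete _ mU).
apply: filterS V_V => w Vw _.
rewrite /U.
have /cvg_limn_einf_sup[_ ->//] : (V_ n w)%:E @[n --> \oo] --> (V w)%:E.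
by apply: cvg_EFin Vw; exact: nearW.
Qed.

Variables (t : R) (tau : Omega -> R).
Hypothesis tT : 0 <= t <= T.
Hypothesis tau_stop : stopping_time_from T F t tau.

Let t0 : 0 <= t. Proof. by case/andP: tT. Qed.
Let t_le_T : t <= T. Proof. by case/andP: tT. Qed.

Let tau_range w : t <= tau w <= T. Proof. by have [+ _] := tau_stop; apply. Qed.

Lemma stopping_time_gt u : t <= u <= T -> F u [set w | u < tau w].
Proof.
move=> /andP[tu uT]; have [_ /(_ u)] := tau_stop.
rewrite uT (le_trans t0 tu) => /(_ isT).
rewrite -filtration_measurableE => /measurableC; congr (measurable _).
by apply/seteqP; split => w /=; rewrite ltNge => /negP.
Qed.

Lemma measurable_stopping_time : measurable_fun setT tau.
Proof.
apply: (measurability _ (RGenOInfty.measurableE R)) => //.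
move=> _ [_ [u ->] <-]; rewrite setTI.
rewrite (_ : _ @^-1` _ = [set w | u < tau w]); last first.
  by apply/seteqP; split => w /=; rewrite in_itv/= andbT.
have [ut|tu] := ltP u t.
  rewrite (_ : [set _ | _] = setT)//; apply/seteqP; split => // w _ /=.
  by have /andP[+ _] := tau_range w; exact: lt_le_trans.
have [uT|Tu] := leP u T.
  by apply: (F_measurable uT); apply: stopping_time_gt; rewrite tu.
rewrite (_ : [set _ | _] = set0)//; apply/seteqP; split => // w /=.
have /andP[_ tauT] := tau_range w => utau.
by have := lt_le_trans (lt_trans Tu utau) tauT; rewrite ltxx.
Qed.

(** The increment of [V] from t to the first grid point at or after [tau]. The inequality is strict
    because [u < tau] is the complement of [tau <= u], hence an event of F u: each increment is
    multiplied by an indicator known at its start. *)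
Definition stopped_increments (V : R -> Omega -> R) n w : R :=
  \sum_(k < n.+1) \1_[set w | grid t T n k < tau w] w *
    (V (grid t T n k.+1) w - V (grid t T n k) w).

Lemma stopped_incrementsE (V : R -> Omega -> R) n w :
  stopped_increments V n w = \sum_(k < n.+1) (grid t T n k < tau w)%R%:R *
    (V (grid t T n k.+1) w - V (grid t T n k) w).
Proof. by apply: eq_bigr => k _; rewrite indicE mem_setE. Qed.

Variable V : R -> Omega -> R.
Hypothesis mV : forall u, t <= u <= T -> measurable_fun setT (V u).
Hypothesis V_continuous :
  {ae P, forall w, {within `[t, T], continuous (fun u => V u w)}}.

Let mgrid n k : (k <= n.+1)%N -> measurable_fun setT (V (grid t T n k)).
Proof. by move=> kn; apply: mV; exact: grid_in. Qed.

Lemma stopped_increments_cvg :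
  {ae P, forall w, stopped_increments V ^~ w @ \oo --> V (tau w) w - V t w}.
Proof.
apply: filterS V_continuous => w cV.
under eq_fun do rewrite stopped_incrementsE.
exact: grid_telescope_cvg cV (tau_range w).
Qed.

Lemma measurable_stopped_increment :
  measurable_fun setT (fun w => V (tau w) w - V t w).
Proof.
apply: ae_cvg_measurable stopped_increments_cvg => n.
apply: measurable_sum => k; apply: measurable_funM.
  have /andP[tk kT] : t <= grid t T n k <= T by apply: grid_in => //; exact: ltnW.
  apply: measurable_indic; apply: (F_measurable kT).
  by apply: stopping_time_gt; exact/andP.
by apply: measurable_funB; apply: mgrid => //; exact: ltnW.
Qed.

Lemma measurable_stopped : measurable_fun setT (fun w => V (tau w) w).
Proof.
have -> : (fun w => V (tau w) w) = (fun w => (V (tau w) w - V t w) + V t w).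
  by apply/funext => w; rewrite subrK.
apply: measurable_funD; first exact: measurable_stopped_increment.
by apply: mV; rewrite lexx.
Qed.

Lemma centered_stopped (g : Omega -> \bar R) :
  (forall u, t <= u <= T -> centered P (F u) (fun w => V T w - V u w)) ->
  P.-integrable setT g ->
  {ae P, forall w, forall n k, (k <= n.+1)%N ->
    (`|V (grid t T n k) w - V t w|%:E <= g w)%E} ->
  centered P (F t) (fun w => V (tau w) w - V t w).
Proof.
move=> cV ig Vg; have Fm := F_measurable t_le_T.
apply: (centered_dominated Fm _ measurable_stopped_increment
  stopped_increments_cvg ig); last first.
  (* A stopped sum is the increment of [V] up to a single grid point, so the bound at grid points
     dominates it uniformly in [n]. *)
  apply: filterS Vg => w Vg n; rewrite stopped_incrementsE.
  have /andP[tt' t'T] := tau_range w.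
  by have [j [jn -> _ _]] := grid_telescope (V ^~ w) n tt' t'T; exact: Vg.
move=> n; apply: (@centered_sum _ _ _ P _ _ (fun k w =>
  \1_[set w | grid t T n k < tau w] w *
    (V (grid t T n k.+1) w - V (grid t T n k) w))) => // k kn.
have /andP[tk kT] : t <= grid t T n k <= T by apply: grid_in => //; exact: ltnW.
have /andP[tk1 k1T] : t <= grid t T n k.+1 <= T by exact: grid_in.
have Fkm := F_measurable kT.
apply: (@sub_centered _ _ _ P (F (grid t T n k))); first exact: F_sub.
apply: centered_indic => //; first by apply: stopping_time_gt; rewrite tk.
(* Only increments up to T are known to be centered; a grid increment is the difference of two of
   them. *)
have -> : (fun w => V (grid t T n k.+1) w - V (grid t T n k) w) =
    (fun w => (V T w - V (grid t T n k) w) + (-1) * (V T w - V (grid t T n k.+1) w)).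
  by apply/funext => w; ring.
apply: centeredD => //; first by apply: cV; rewrite tk.
apply: centeredZ => //; apply: (@sub_centered _ _ _ P (F (grid t T n k.+1))).
  by apply: F_sub; exact: grid_le.
by apply: cV; rewrite tk1.
Qed.

End stopping_times.

(** * First contact with the barrier *)

Section first_contact.
Context {R : realType} {d : measure_display} {Omega : measurableType d}.
Variables (T t : R) (tT : t <= T).
Variables (L Y : R -> Omega -> R).

Let contacts w := [set u | t <= u <= T /\ Y u w = L u w] `|` [set T].

Let has_inf_contacts w : has_inf (contacts w).
Proof.
split; first by exists T; right.
by exists t => u [[/andP[]]|->].
Qed.

Lemma first_contact_range w : t <= first_contact T L t Y w <= T.
Proof.
apply/andP; split.
  by apply: lb_le_inf; [exists T; right|move=> u [[/andP[]]|->]].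
by apply: ge_inf; [case: (has_inf_contacts w)|right].
Qed.

Lemma lt_first_contact w u : t <= u -> u < first_contact T L t Y w -> Y u w <> L u w.
Proof.
move=> tu uc YL; move: uc; rewrite ltNge => /negP; apply.
have /andP[_ cT] := first_contact_range w.
have [uT|/ltW Tu] := leP u T; last exact: le_trans Tu.
apply: ge_inf; first by case: (has_inf_contacts w).
by left; split => //; rewrite tu.
Qed.

Variable w : Omega.
Hypothesis YL_continuous : {within `[t, T], continuous (fun u => Y u w - L u w)}.
Hypothesis L_le_Y : forall u, t <= u <= T -> L u w <= Y u w.

Local Notation c := (first_contact T L t Y w).

(** Contact points accumulate at the infimum or equal it, and there Y - L vanishes; continuity
    excludes a nonzero value at the infimum. *)
Lemma first_contact_attained : c < T -> Y c w = L c w.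
Proof.
move=> cT; apply: contrapT => /eqP; rewrite -subr_eq0 -normr_gt0 => h0.
have [e e0 H] := within_continuousP YL_continuous (first_contact_range w) h0.
(* Staying within T - c of the infimum excludes the adjoined point T. *)
have e'0 : 0 < Num.min e (T - c) by rewrite lt_min e0 subr_gt0.
have [s Ss sc] := inf_adherent e'0 (has_inf_contacts w).
have cs : c <= s by apply: ge_inf => //; case: (has_inf_contacts w).
case: Ss => [[sT YL]|sT].
- have /(H s sT) : `|s - c| < e.
    rewrite ger0_norm ?subr_ge0// ltrBlDl (lt_le_trans sc)//.
    by rewrite lerD2l ge_min lexx.
  by rewrite YL subrr sub0r normrN ltxx.
- by move: sc; rewrite sT ltNge => /negP; apply; rewrite addrC -lerBrDr ge_min lexx orbT.
Qed.

(** On the compact [t, u] a continuous nonnegative function vanishes somewhere exactly when it takes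
    arbitrarily small values on a countable dense set. Only countably many times, none later than
    [u], enter the right-hand side, so it describes an event of F u. *)
Lemma first_contact_le_grid u : t <= u < T -> c <= u <->
  forall m, exists n k, (k <= n.+1)%N /\
    Y (grid t u n k) w - L (grid t u n k) w < m.+1%:R^-1.
Proof.
move=> /andP[tu uT].
have inT x : t <= x <= u -> t <= x <= T.
  by move=> /andP[-> /= /le_trans]; apply; exact: ltW.
have cu : {within `[t, u], continuous (fun u => Y u w - L u w)}.
  apply: continuous_subspaceW YL_continuous => x /=; rewrite !in_itv/=; exact: inT.
split=> [cu' m|H].
  have YLc := first_contact_attained (le_lt_trans cu' uT).
  have /andP[tc _] := first_contact_range w.
  have tcu : t <= c <= u by rewrite tc.
  have m0 : 0 < m.+1%:R^-1 :> R by rewrite invr_gt0.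
  have [e e0 He] := within_continuousP cu tcu m0.
  have [n [k [kn nk]]] := grid_dense tcu e0.
  exists n, k; split => //.
  have := He (grid t u n k); rewrite grid_in// => /(_ isT nk).
  by rewrite YLc subrr subr0; exact: le_lt_trans (ler_norm _).
(* Without contact up to [u] the minimum over [t, u] is positive, and some 1/(m+1) lies below it. *)
have [x] := EVT_min tu cu; rewrite in_itv/= => xu xmin.
have /andP[tx xu'] := xu.
rewrite leNgt; apply/negP => uc.
have hx : 0 < Y x w - L x w.
  rewrite subr_gt0 lt_neqAle L_le_Y ?inT// andbT eq_sym; apply/eqP.
  by apply: lt_first_contact => //; exact: le_lt_trans xu' uc.
have [m xm] : exists m, m.+1%:R^-1 < Y x w - L x w.
  have [m _ /(_ m (leqnn m))] := near_infty_natSinv_lt (PosNum hx).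
  by move=> /= ?; exists m.
have [n [k [kn]]] := H m; apply/negP; rewrite -leNgt.
apply: (le_trans (ltW xm)); apply: xmin; rewrite in_itv/=; exact: grid_in.
Qed.

End first_contact.

Lemma first_contact_stopping_time {R : realType} {d : measure_display}
    {Omega : measurableType d} (P : probability Omega R) (T : R)
    (F : R -> set (set Omega)) (t : R) (L Y : R -> Omega -> R) :
  (forall u, sigma_algebra setT (F u)) ->
  (forall s u, s <= u -> F s `<=` F u) ->
  (forall u N, P.-negligible N -> F u N) ->
  0 <= t <= T -> adapted T F L -> adapted T F Y ->
  {ae P, forall w, {within `[t, T], continuous (fun u => Y u w - L u w)}} ->
  {ae P, forall w, forall u, t <= u <= T -> L u w <= Y u w} ->
  stopping_time_from T F t (first_contact T L t Y).
Proof.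
move=> Fsigma Fsub Fneg /andP[t0 tT] aL aY cYL YL.
split; first by move=> w; exact: first_contact_range.
move=> u /andP[u0 uT].
have [ut|tu] := ltP u t.
  rewrite (_ : [set _ | _] = set0); first by apply: Fneg; exact: negligible_set0.
  apply/seteqP; split => // w /=.
  have /andP[tc _] := first_contact_range tT L Y w => cu.
  by have := le_lt_trans (le_trans tc cu) ut; rewrite ltxx.
(* At [u = T] the event is the whole space, since the infimum never exceeds T; a contact has to be
   detected only for [u < T]. *)
move: uT; rewrite le_eqVlt => /predU1P[->|uT].
  rewrite (_ : [set _ | _] = setT).
    have [F0 FC _] := Fsigma T; rewrite -(setD0 setT); exact: FC.
  by apply/seteqP; split => // w _ /=; have /andP[] := first_contact_range tT L Y w.
pose B : set Omega := \bigcap_m \bigcup_n \bigcup_(k in [set k | (k <= n.+1)%N])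
  [set w | Y (grid t u n k) w - L (grid t u n k) w < m.+1%:R^-1].
(* The grid description is valid on almost every path; the null sets of F u absorb the others. *)
apply: (filtration_negligible Fsigma Fneg (A := B)).
  rewrite -(filtration_measurableE Fsigma).
  apply: bigcapT_measurable => m; apply: bigcupT_measurable => n.
  apply: bigcup_measurable => k /= kn.
  have /andP[tk ku] := grid_in tu kn.
  have mV V : adapted T F V -> measurable_fun [set: g_sigma_algebraType (F u)] (V (grid t u n k)).
    move=> aV; apply: sub_measurable_sigmaType => //.
    have kT : 0 <= grid t u n k <= T by rewrite (le_trans t0 tk) (le_trans ku)// ltW.
    by apply: subset_trans (aV _ kT) _; exact: Fsub.
  have mD : measurable_fun [set: g_sigma_algebraType (F u)]
      (fun w => Y (grid t u n k) w - L (grid t u n k) w).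
    by apply: measurable_funB; exact: mV.
  rewrite (_ : [set _ | _] = (fun w => Y (grid t u n k) w - L (grid t u n k) w) @^-1`
    `]-oo, m.+1%:R^-1[%classic); last first.
    by apply/seteqP; split => w /=; rewrite in_itv.
  by rewrite -[X in measurable X]setTI; apply: mD => //; exact: measurable_itv.
have good : {ae P, forall w, first_contact T L t Y w <= u <-> B w}.
  apply: filterS2 cYL YL => w cw Lw.
  have := first_contact_le_grid tT cw Lw (u := u); rewrite tu uT => /(_ isT) [H1 H2].
  split=> [/H1 H m _|H].
    by have [n [k [kn nk]]] := H m; exists n => //; exists k.
  by apply: H2 => m; have [n _ [k kn nk]] := H m I; exists n, k.
apply: negligibleS good => w [[Bw nc]|[cw nB]] /= [H1 H2].
  by apply: nc; exact: H2.
by apply: nB; exact: H1.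
Qed.

(** * Joint measurability and integrals *)

Section integral_facts.
Context {R : realType} {d : measure_display} {Omega : measurableType d}.
Variable mu : {measure set Omega -> \bar R}.

(* No measurability: the integral of a nonnegative function is a lower integral. *)
Lemma ge0_le_lower_integral (f g : Omega -> \bar R) :
  (forall w, 0 <= f w)%E -> (forall w, f w <= g w)%E ->
  (\int[mu]_w f w <= \int[mu]_w g w)%E.
Proof.
move=> f0 fg; rewrite !ge0_integralTE//; last by move=> w; exact: le_trans (fg w).
by apply: ereal_sup_le => _ [h hf <-]; exists h => // w; exact: le_trans (fg w).
Qed.

Lemma ge0_integrable (f : Omega -> \bar R) : measurable_fun setT f ->
  (forall w, 0 <= f w)%E -> (\int[mu]_w f w < +oo)%E -> mu.-integrable setT f.
Proof.
by move=> mf f0 foo; apply/integrableP; split=> //; under eq_integral do rewrite gee0_abs//.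
Qed.

(** Positive and negative parts are compared separately: only the positive part of L has a
    controlled moment, so a payoff may have expectation -oo. *)
Lemma ae_le_integral (D : set Omega) (f g : Omega -> \bar R) : measurable D ->
  measurable_fun setT f -> measurable_fun setT g ->
  {ae mu, forall w, D w -> (f w <= g w)%E} ->
  (\int[mu]_(w in D) f w <= \int[mu]_(w in D) g w)%E.
Proof.
move=> mD mf mg fg; rewrite integralE [leRHS]integralE; apply: leeB.
  apply: ae_ge0_le_integral => //; try by apply: measurable_funTS;
    exact: measurable_funepos.
  apply: filterS fg => w + Dw => /(_ Dw) fgw; rewrite !funeposE.
  by rewrite ge_max !le_max fgw lexx orbT.
apply: ae_ge0_le_integral => //; try by apply: measurable_funTS;
  exact: measurable_funeneg.
apply: filterS fg => w + Dw => /(_ Dw) fgw; rewrite !funenegE.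
by rewrite ge_max !le_max leeN2 fgw lexx orbT.
Qed.

End integral_facts.

Section joint_measurability.
Context {R : realType} {d : measure_display} {Omega : measurableType d}.
Variables (G : set (set Omega)) (T : R) (v : R -> Omega -> R).
Hypothesis G_measurable : G `<=` measurable.
Hypothesis v_measurable : jointly_measurable T G v.

Lemma jointly_measurable_fun : measurable_fun
  (`[0, T] `*` setT : set (measurableTypeR R * Omega)) (fun p => v p.1 p.2).
Proof.
move=> _ B mB.
have : rectangles_sigma G ((`[0, T] `*` setT) `&` (fun p : R * Omega => v p.1 p.2) @^-1` B).
  by apply: v_measurable; exists B.
apply; split; first exact: (@sigma_algebra_measurable _ (measurableTypeR R * Omega)%type).
by move=> _ [A mA [C GC <-]]; apply: measurableX => //; exact: G_measurable.
Qed.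

Lemma measurable_fun_section w : measurable_fun (`[0, T] : set (measurableTypeR R)) (v ^~ w).
Proof.
apply: (measurable_comp (F := `[0, T] `*` setT) _ _ jointly_measurable_fun
  (g := fun s : measurableTypeR R => (s, w))).
- by apply: measurableX.
- by move=> _ [s sT <-].
- by apply: measurable_funTS; exact: pair2_measurable.
Qed.

Variables (t : R) (tau : Omega -> R).
Hypotheses (t0 : 0 <= t) (tauT : forall w, tau w <= T) (mtau : measurable_fun setT tau).

(** Tonelli's theorem for [h] of [v], cut off to the region between [t] and the graph of [tau]. In
    the applications [h] is the positive part, the negative part or the absolute value. *)
Lemma measurable_integral_upto (h : R -> \bar R) :
  measurable_fun [set: R] h -> (forall x, 0 <= h x)%E ->
  measurable_fun setT (fun w =>
    \int[lebesgue_measure]_(s in `[t, tau w]) h (v s w))%E.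
Proof.
move=> mh h0.
pose E : set (measurableTypeR R * Omega) := [set p | t <= p.1 <= tau p.2].
have mE : measurable E.
  have m1 : measurable_fun setT (fun p : measurableTypeR R * Omega => (p.1 : R)).
    exact: measurable_fst.
  have m2 : measurable_fun setT (fun p : measurableTypeR R * Omega => tau p.2 - p.1).
    apply: measurable_funB => //.
    by apply: (measurableT_comp mtau); exact: measurable_snd.
  rewrite (_ : E = (fun p : measurableTypeR R * Omega => (p.1 : R)) @^-1` `[t, +oo[%classic `&`
     (fun p : measurableTypeR R * Omega => tau p.2 - p.1) @^-1` `[0, +oo[%classic).
    apply: measurableI; rewrite -[X in measurable X]setTI.
      by apply: m1 => //; exact: measurable_itv.
    by apply: m2 => //; exact: measurable_itv.
  by apply/seteqP; split => -[s w]; rewrite /E /= !in_itv/= !andbT subr_ge0 => /andP.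
have ET : E `<=` `[0, T] `*` setT.
  move=> [s w] /= /andP[ts st]; split => //=.
  by rewrite in_itv/= (le_trans t0 ts) (le_trans st).
pose f := (fun p : measurableTypeR R * Omega => h (v p.1 p.2)) \_ E.
have mf : measurable_fun setT f.
  have mET : measurable (`[0, T] `*` setT : set (measurableTypeR R * Omega)).
    by apply: measurableX.
  have mhv := measurableT_comp mh jointly_measurable_fun.
  exact: (measurable_restrictT _ mE).1 (measurable_funS mET ET mhv).
have f0 p : (0 <= f p)%E by rewrite /f patchE; case: ifP.
have := measurable_fun_fubini_tonelli_G (m1 := lebesgue_measure) f mf f0.
congr (measurable_fun _ _); apply/funext => w; rewrite /fubini_G [RHS]integral_mkcond.
apply: eq_integral => s _; rewrite /f !patchE; congr (if _ then _ else _).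
Qed.

Lemma measurable_Rintegral_upto : measurable_fun setT (fun w =>
  \int[lebesgue_measure]_(s in `[t, tau w]) v s w).
Proof.
apply: (measurableT_comp (fine_measurable _)) => //.
under eq_fun do rewrite integralE.
apply: emeasurable_funB.
  under eq_fun do under eq_integral do rewrite funeposE -EFin_max.
  apply: (measurable_integral_upto (h := fun x => (Num.max x 0)%:E)).
    by apply/measurable_EFinP; exact: measurable_maxr.
  by move=> x; rewrite lee_fin le_max lexx orbT.
under eq_fun do under eq_integral do rewrite funenegE -EFinN -EFin_max.
apply: (measurable_integral_upto (h := fun x => (Num.max (- x) 0)%:E)).
  apply/measurable_EFinP; apply: measurable_maxr => //; exact: oppr_measurable.
by move=> x; rewrite lee_fin le_max lexx orbT.
Qed.

End joint_measurability.

(** * The reflected equation *)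

Section reflected_bsde.
Context {R : realType} {d : measure_display} {Omega : measurableType d}.
Variables (P : probability Omega R) (T : R) (W : R -> Omega -> R).
Local Notation F := (brownian_filtration P W).
Hypothesis P_complete : measure_is_complete P.
Hypothesis bm : standard_brownian_motion P W T.
Variables (g : R -> R -> Omega -> R) (xi L : R -> Omega -> R).
Variables (t : R) (Y Z K M : R -> Omega -> R).
Hypothesis tT : 0 <= t <= T.
Hypothesis g_progressive : progressively_measurable T F (g t).
Hypothesis g_moment : assumption_A2a P T g.
Hypothesis L_adapted : adapted T F L.
Hypothesis L_continuous : {ae P, forall w, continuous_path T L w}.
Hypothesis sol : reflected_bsde_solution P T F g xi L W t Y Z K.
Hypothesis M_ito : is_ito_integral P T F W Z M.
Hypothesis Y_eq : {ae P, forall w, forall u : R, t <= u <= T ->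
  Y u w = xi t w + \int[lebesgue_measure]_(s in `[u, T]) g t s w
          + (K T w - K u w) - (M T w - M u w)}.

Let t0 : 0 <= t. Proof. by case/andP: tT. Qed.
Let t_le_T : t <= T. Proof. by case/andP: tT. Qed.
Let TT : 0 <= T <= T. Proof. by rewrite (le_trans t0 t_le_T) lexx. Qed.
Let in0T u : t <= u <= T -> 0 <= u <= T.
Proof. by move=> /andP[/(le_trans t0)-> ->]. Qed.

Let Fm u : u <= T -> F u `<=` measurable.
Proof. exact: (brownian_filtration_measurable P_complete bm). Qed.

Let adapted_measurable (V : R -> Omega -> R) u :
  adapted T F V -> 0 <= u <= T -> measurable_fun setT (V u).
Proof.
by move=> aV uT; apply: sub_measurable_fun (aV u uT); apply: Fm; case/andP: uT.
Qed.

Let aY : adapted T F Y. Proof. by have [] := rb_Y sol. Qed.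
Let aM : adapted T F M. Proof. by have [] := M_ito. Qed.

Let g_joint : jointly_measurable T (F T) (g t).
Proof. exact: g_progressive. Qed.

Let I u w := \int[lebesgue_measure]_(s in `[t, u]) g t s w.
Let A w := (\int[lebesgue_measure]_(s in `[t, T]) `|g t s w|%:E)%E.

Let measurable_A : measurable_fun setT A.
Proof.
have mabs : measurable_fun [set: R] (fun x : R => `|x|%:E).
  by apply/measurable_EFinP; exact: normr_measurable.
by have := measurable_integral_upto (Fm (lexx T)) g_joint t0 (fun=> lexx T)
  (@measurable_cst _ _ Omega _ setT T) mabs; apply.
Qed.

Let A_ge0 w : (0 <= A w)%E.
Proof. by apply: integral_ge0 => s _; rewrite lee_fin. Qed.

(** Trades first moments for second ones: the hypotheses control squares, while domination asks for
    integrable functions. *)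
Let le_1Dsqr (x : R) : x <= 1 + x ^+ 2.
Proof. by have := sqr_ge0 (x - 1); have := sqr_ge0 x; nra. Qed.

Let integrable_A : P.-integrable setT A.
Proof.
have A2 : (\int[P]_w (A w) ^+ 2 < +oo)%E.
  apply: le_lt_trans g_moment; apply: ereal_sup_ubound.
  by exists t => //=; rewrite in_itv.
have mA2 : measurable_fun setT (fun w => A w ^+ 2)%E.
  by under eq_fun do rewrite expe2; exact: emeasurable_funM.
apply: ge0_integrable => //.
apply: (@le_lt_trans _ _ (\int[P]_w (1 + A w ^+ 2))%E).
  apply: ge0_le_integral => //.
  - by apply: emeasurable_funD.
  - move=> w _; have := A_ge0 w; case: (A w) => [x|//|//].
    by rewrite -EFin_expe -EFinD !lee_fin => _; exact: le_1Dsqr.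
rewrite ge0_integralD//; last by move=> w _; rewrite expe_ge0.
rewrite integral_cst// [X in (_ * X + _)%E](@probability_setT _ _ _ P) mule1.
by rewrite lte_add_pinfty// ltry.
Qed.

Let g_integrable : {ae P, forall w,
  lebesgue_measure.-integrable `[t, T] (EFin \o (g t ^~ w))}.
Proof.
have := integrable_ae measurableT integrable_A; apply: filterS => w /(_ Logic.I) Afin.
apply/integrableP; split; last first.
  have Aoo : (A w < +oo)%E by rewrite -ge0_fin_numE.
  exact: Aoo.
apply/measurable_EFinP.
have mgw := measurable_fun_section (Fm (lexx T)) g_joint w.
apply: (measurable_funS _ _ mgw); first exact: measurable_itv.
by move=> s /=; rewrite !in_itv/= => /in0T.
Qed.

Let dynamics : {ae P, forall w, forall u, t <= u <= T ->
  Y u w = Y t w - I u w - (K u w - K t w) + (M u w - M t w)}.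
Proof.
apply: filterS2 g_integrable Y_eq => w gw Yw u /andP[tu uT].
have tt : t <= t <= T by rewrite lexx t_le_T.
rewrite (Yw u) ?tu// (Yw t)//.
have <- : I T w - I u w = \int[lebesgue_measure]_(s in `[u, T]) g t s w.
  rewrite /I (@Rintegral_itvB _ _ (BLeft t) (BRight T) u)//.
  apply: Rintegral_itv_obnd_cbnd.
  by apply: integrableS gw => //; apply: subset_itvr; rewrite bnd_simp.
rewrite /I; ring.
Qed.

Let Y_terminal : {ae P, forall w, Y T w = xi t w}.
Proof.
apply: filterS Y_eq => w /(_ T); rewrite lexx t_le_T => /(_ isT) ->.
by rewrite set_itv1 Rintegral_set1 !subrr !addr0 subr0.
Qed.

Let sub_continuous (h : R -> R) : {within `[0, T], continuous h} ->
  {within `[t, T], continuous h}.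
Proof.
by apply: continuous_subspaceW => u /=; rewrite !in_itv/=; exact: in0T.
Qed.

Let M_continuous : {ae P, forall w, {within `[t, T], continuous (M ^~ w)}}.
Proof. by have [_ + _] := M_ito; apply: filterS => w /sub_continuous. Qed.

Let K_continuous : {ae P, forall w, {within `[t, T], continuous (K ^~ w)}}.
Proof. by have := rb_K_continuous sol; apply: filterS => w /sub_continuous. Qed.

(** Membership of Y in S^2 says nothing about its paths; continuity comes from [dynamics], whose
    right-hand side is continuous in [u] term by term. *)
Let YL_continuous :
  {ae P, forall w, {within `[t, T], continuous (fun u => Y u w - L u w)}}.
Proof.
near=> w.
have gw : lebesgue_measure.-integrable `[t, T] (EFin \o (g t ^~ w)).
  by near: w; exact: g_integrable.
have Ic : {within `[t, T], continuous (I ^~ w)}.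
  exact: parameterized_integral_continuous t_le_T gw.
have Mc : {within `[t, T], continuous (M ^~ w)} by near: w.
have Kc : {within `[t, T], continuous (K ^~ w)} by near: w.
have Lc : {within `[t, T], continuous (L ^~ w)}.
  by apply: sub_continuous; near: w.
have Yw : forall u, t <= u <= T ->
    Y u w = Y t w - I u w - (K u w - K t w) + (M u w - M t w).
  by near: w; exact: dynamics.
apply: (@subspace_eq_continuous _ _ _
  (fun u => (Y t w - I u w - (K u w - K t w) + (M u w - M t w)) - L u w)).
  by move=> u; rewrite inE/= in_itv/= => /Yw Yuw; rewrite /from_subspace/= Yuw.
move=> u; apply: (@cvgB _ R^o); last exact: Lc.
apply: (@cvgD _ R^o); last by apply: (@cvgB _ R^o); [exact: Mc|exact: cvg_cst].
apply: (@cvgB _ R^o); last by apply: (@cvgB _ R^o); [exact: Kc|exact: cvg_cst].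
by apply: (@cvgB _ R^o); [exact: cvg_cst|exact: Ic].
Unshelve. all: by end_near. Qed.

Let L_le_Y : {ae P, forall w, forall u, t <= u <= T -> L u w <= Y u w}.
Proof.
have LYgrid : {ae P, forall w, forall n k, (k <= n.+1)%N ->
    0 <= Y (grid t T n k) w - L (grid t T n k) w}.
  apply: ae_foralln => n; apply: ae_foralln => k.
  have [kn|nk] := leqP k n.+1; last exact: aeW.
  by apply: filterS (rb_barrier sol (grid_in t_le_T kn)) => w; rewrite subr_ge0.
apply: filterS2 YL_continuous LYgrid => w cw Lw u tuT.
by rewrite -subr_ge0; exact: (within_continuous_ge0 cw Lw).
Qed.

(** * The first contact time and payoffs along a path *)

Local Notation tau_star := (first_contact T L t Y).

Lemma reflected_first_contact_stopping_time : stopping_time_from T F t tau_star.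
Proof.
apply: (first_contact_stopping_time (P := P)) => //.
- exact: brownian_filtration_sigma_algebra.
- exact: brownian_filtration_sub.
- by move=> u N; exact: negligible_brownian_filtration.
Qed.

(* Flatness holds on each compact [t, b] with b < tau_star a grid point, and passes
   to tau_star by continuity of K. *)
Let K_flat : {ae P, forall w, K (tau_star w) w = K t w}.
Proof.
have Kgrid : {ae P, forall w, forall n k, (k <= n.+1)%N -> t < grid t T n k ->
    (forall u, t <= u <= grid t T n k -> L u w < Y u w) ->
    K t w = K (grid t T n k) w}.
  apply: ae_foralln => n; apply: ae_foralln => k.
  have [kn|nk] := leqP k n.+1; last exact: aeW.
  have [tk|kt] := ltP t (grid t T n k); last exact: aeW.
  have /andP[_ kT] := grid_in t_le_T kn (n := n).
  by apply: filterS (rb_K_flat sol t0 tk kT) => w + _ _.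
near=> w.
have Kw : forall n k, (k <= n.+1)%N -> t < grid t T n k ->
    (forall u, t <= u <= grid t T n k -> L u w < Y u w) ->
    K t w = K (grid t T n k) w by near: w.
have Kc : {within `[t, T], continuous (K ^~ w)} by near: w.
have LY : forall u, t <= u <= T -> L u w <= Y u w by near: w.
have c_range := first_contact_range t_le_T L Y w.
have /andP[+ cT] := c_range; rewrite le_eqVlt => /predU1P[<-//|tc].
apply: contrapT => /eqP; rewrite -subr_eq0 -normr_gt0 => K0.
have [e e0 He] := within_continuousP Kc c_range K0.
(* A grid point within [r] of tau_star - r lies strictly between tau_star - 2r and tau_star, hence
   after t and within [e] of tau_star. *)
pose r := Num.min e (tau_star w - t) / 2.
have r0 : 0 < r by rewrite divr_gt0// lt_min e0 subr_gt0.
have re : r + r <= e by rewrite -splitr ge_min lexx.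
have rc : r + r <= tau_star w - t by rewrite -splitr ge_min lexx orbT.
have mid : t <= tau_star w - r <= T by lra.
have [n [k [kn]]] := grid_dense mid r0.
rewrite ltr_norml => /andP[b1 b2].
have tb : t < grid t T n k by lra.
have bc : grid t T n k < tau_star w by lra.
have /(He _ (grid_in t_le_T kn)) : `|grid t T n k - tau_star w| < e.
  by rewrite ltr_norml; apply/andP; split; lra.
suff <- : K t w = K (grid t T n k) w by rewrite distrC ltxx.
apply: Kw => // u /andP[tu ub]; have uc := le_lt_trans ub bc.
have tuT : t <= u <= T by rewrite tu ltW// (lt_le_trans uc).
rewrite lt_neqAle (LY u tuT) andbT eq_sym; apply/eqP.
exact: (lt_first_contact t_le_T tu uc).
Unshelve. all: by end_near. Qed.

Lemma payoff_le tau : stopping_time_from T F t tau ->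
  {ae P, forall w, payoff T g xi L t tau w <= Y t w + (M (tau w) w - M t w)}.
Proof.
move=> [tau_range _]; near=> w.
have YT : Y T w = xi t w by near: w; exact: Y_terminal.
have LY : forall u, t <= u <= T -> L u w <= Y u w by near: w; exact: L_le_Y.
have Yw : forall u, t <= u <= T ->
    Y u w = Y t w - I u w - (K u w - K t w) + (M u w - M t w).
  by near: w; exact: dynamics.
have Kw : forall a b : R, 0 <= a -> a <= b -> b <= T -> K a w <= K b w.
  by near: w; exact: (rb_K_increasing sol).
have /andP[tw wT] := tau_range w.
have := Kw _ _ t0 tw wT; have := Yw _ (tau_range w).
rewrite /payoff -/(I (tau w) w) !indicE.
move: wT; rewrite le_eqVlt => /predU1P[Tw|wT].
  by rewrite memNset/= ?Tw ?ltxx// mem_set//= mulr0 mulr1 addr0 -YT => ->; lra.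
have := LY _ (tau_range w); rewrite mem_set//= memNset/=; last first.
  by move=> E; move: wT; rewrite E ltxx.
by rewrite mulr1 mulr0 addr0; lra.
Unshelve. all: by end_near. Qed.

Lemma payoff_first_contact : {ae P, forall w,
  payoff T g xi L t tau_star w = Y t w + (M (tau_star w) w - M t w)}.
Proof.
near=> w.
have YT : Y T w = xi t w by near: w; exact: Y_terminal.
have LY : forall u, t <= u <= T -> L u w <= Y u w by near: w; exact: L_le_Y.
have YL : {within `[t, T], continuous (fun u => Y u w - L u w)}.
  by near: w; exact: YL_continuous.
have Yw : forall u, t <= u <= T ->
    Y u w = Y t w - I u w - (K u w - K t w) + (M u w - M t w).
  by near: w; exact: dynamics.
have Kw : K (tau_star w) w = K t w by near: w; exact: K_flat.
have c_range := first_contact_range t_le_T L Y w.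
have := Yw _ c_range; rewrite Kw subrr subr0.
rewrite /payoff -/(I (tau_star w) w) !indicE.
have /andP[_] := c_range; rewrite le_eqVlt => /predU1P[Tw|wT].
  by rewrite memNset/= ?Tw ?ltxx// mem_set//= mulr0 mulr1 addr0 -YT => ->; ring.
have := first_contact_attained t_le_T YL wT; rewrite mem_set//= memNset/=; last first.
  by move=> E; move: wT; rewrite E ltxx.
by rewrite mulr1 mulr0 addr0 => <- ->; ring.
Unshelve. all: by end_near. Qed.

Let measurable_xi : measurable_fun setT (xi t).
Proof.
(* [xi t] agrees almost surely with the adapted variable Y T, viewed as the limit of a constant
   sequence. *)
apply: (ae_cvg_measurable P_complete (fun _ : nat => adapted_measurable aY TT)).
by apply: filterS Y_terminal => w ->; exact: cvg_cst.
Qed.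

Lemma measurable_payoff tau : stopping_time_from T F t tau ->
  measurable_fun setT (payoff T g xi L t tau).
Proof.
move=> stau; have tau_range := stau.1.
have mtau : measurable_fun setT tau.
  apply: (measurable_stopping_time _ _ tT stau) => //.
  exact: brownian_filtration_sigma_algebra.
have tauT w : tau w <= T by have /andP[] := tau_range w.
apply: measurable_funD; last first.
  apply: measurable_funM => //; apply: measurable_indic.
  rewrite (_ : [set _ | _] = tau @^-1` [set T])//.
  by rewrite -[X in measurable X]setTI; exact: mtau.
apply: measurable_funD; first exact: (measurable_Rintegral_upto (Fm (lexx T)) g_joint).
apply: measurable_funM.
  apply: (measurable_stopped P_complete _ Fm tT stau).
  - exact: brownian_filtration_sigma_algebra.
  - by move=> u /in0T; exact: adapted_measurable.
  - by apply: filterS L_continuous => w /sub_continuous.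
apply: measurable_indic.
rewrite (_ : [set _ | _] = tau @^-1` `]-oo, T[%classic); last first.
  by apply/seteqP; split => w /=; rewrite in_itv.
by rewrite -[X in measurable X]setTI; apply: mtau => //; exact: measurable_itv.
Qed.

(** A single enumeration of all grid points of [t, T]; codes that name none are sent to [t], itself
    a grid point. *)
Let gridpt (i : nat) : R :=
  let nk := odflt (0, 0)%N (unpickle i) in
  if (nk.2 <= nk.1.+1)%N then grid t T nk.1 nk.2 else t.

Let gridpt_in i : t <= gridpt i <= T.
Proof. by rewrite /gridpt; case: ifP => [/(grid_in t_le_T)//|_]; rewrite lexx. Qed.

(* A countable supremum: the one in in_S2 need not be measurable. *)
Let S w := esups (fun i => (`|Y (gridpt i) w| ^+ 2)%:E) 0.

Let S_ubound i w : ((`|Y (gridpt i) w| ^+ 2)%:E <= S w)%E.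
Proof. by apply: ereal_sup_ubound; exists i. Qed.

Let S_ge0 w : (0 <= S w)%E.
Proof. by apply: le_trans (S_ubound 0 w); rewrite lee_fin sqr_ge0. Qed.

Let grid_le_S n k w : (k <= n.+1)%N -> (`|Y (grid t T n k) w|%:E <= 1 + S w)%E.
Proof.
move=> kn; have -> : grid t T n k = gridpt (pickle (n, k)).
  by rewrite /gridpt pickleK/= kn.
apply: le_trans (leeD2l 1%E (S_ubound (pickle (n, k)) w)).
by rewrite -EFinD lee_fin le_1Dsqr.
Qed.

Let integrable_S : P.-integrable setT S.
Proof.
apply: ge0_integrable => //.
  apply: measurable_fun_esups => i; apply/measurable_EFinP/measurable_funX.
  by apply: measurableT_comp => //; apply: adapted_measurable (in0T (gridpt_in i)).
have [_] := rb_Y sol; apply: le_lt_trans; apply: ge0_le_lower_integral => // w.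
apply: ge_ereal_sup => _ [i _ <-]; apply: ereal_sup_ubound.
by exists (gridpt i) => //=; rewrite in_itv/= (in0T (gridpt_in i)).
Qed.

Let K2 w := (`|K T w| ^+ 2)%:E.

Let integrable_K2 : P.-integrable setT K2.
Proof.
have [mK K2oo] := rb_K sol; apply: ge0_integrable => //.
- by apply/measurable_EFinP/measurable_funX; exact: measurableT_comp.
- by move=> w; rewrite lee_fin sqr_ge0.
Qed.

Let integrable_1S : P.-integrable setT (fun w => 1 + S w)%E.
Proof. by apply: integrableD => //; exact: finite_measure_integrable_cst. Qed.

(** The summands bound |Y v|, |Y t|, the time integral and K v - K t at a grid point v. The last
    bound uses 0 = K 0 <= K t, so that K v - K t <= K T. *)
Let B w := ((1 + S w) + (1 + S w) + A w + (1 + K2 w))%E.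

Let integrable_B : P.-integrable setT B.
Proof.
apply: integrableD => //.
  by apply: integrableD => //; exact: integrableD.
by apply: integrableD => //; exact: finite_measure_integrable_cst.
Qed.

Let M_bound : {ae P, forall w, forall n k, (k <= n.+1)%N ->
  (`|M (grid t T n k) w - M t w|%:E <= B w)%E}.
Proof.
near=> w => n k kn; set v := grid t T n k.
have gw : lebesgue_measure.-integrable `[t, T] (EFin \o (g t ^~ w)).
  by near: w; exact: g_integrable.
have Yw : forall u, t <= u <= T ->
    Y u w = Y t w - I u w - (K u w - K t w) + (M u w - M t w).
  by near: w; exact: dynamics.
have Kw : forall a b : R, 0 <= a -> a <= b -> b <= T -> K a w <= K b w.
  by near: w; exact: (rb_K_increasing sol).
have K0 : K 0 w = 0 by near: w; exact: (rb_K_start sol).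
have tvT : t <= v <= T by exact: grid_in.
have /andP[tv vT] := tvT.
have IA : (`|I v w|%:E <= A w)%E.
  have gv : lebesgue_measure.-integrable `[t, v] (EFin \o (g t ^~ w)).
    by apply: integrableS gw => //; apply: subset_itvl; rewrite bnd_simp.
  rewrite /I EFin_normr_Rintegral//.
  apply: (le_trans (le_abse_integral _ _ (measurable_int _ gv))) => //.
  apply: ge0_subset_integral => //; last by apply: subset_itvl; rewrite bnd_simp.
  exact: (measurableT_comp (@abse_measurable R setT) (measurable_int _ gw)).
have KB : (`|K v w - K t w|%:E <= 1 + K2 w)%E.
  rewrite -EFinD lee_fin.
  have := Kw _ _ (lexx 0) t0 t_le_T; rewrite K0 => Kt.
  have Ktv := Kw _ _ t0 tv vT; have KvT := Kw _ _ (le_trans t0 tv) vT (lexx T).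
  rewrite (le_trans _ (le_1Dsqr _))// ger0_norm ?subr_ge0// (le_trans _ (ler_norm _))//.
  by rewrite lerBlDr ler_wpDr.
have -> : M v w - M t w = Y v w - Y t w + I v w + (K v w - K t w).
  by rewrite (Yw v)//; ring.
apply: (@le_trans _ _ (`|Y v w| + `|Y t w| + `|I v w| + `|K v w - K t w|)%:E).
  rewrite lee_fin (le_trans (ler_normD _ _))// lerD2r.
  by rewrite (le_trans (ler_normD _ _))// lerD2r ler_normB.
rewrite !EFinD; apply: leeD => //; apply: leeD => //; apply: leeD.
  exact: grid_le_S.
by have := grid_le_S w (leq0n 1); rewrite grid0.
Unshelve. all: by end_near. Qed.

(** * Expectations and conditional expectations of payoffs *)

Let centered_M tau : stopping_time_from T F t tau ->
  centered P (F t) (fun w => M (tau w) w - M t w).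
Proof.
move=> stau; apply: (centered_stopped P_complete _ _ Fm tT stau _ _ _ integrable_B) => //.
- exact: brownian_filtration_sigma_algebra.
- exact: brownian_filtration_sub.
- by move=> u /in0T; exact: adapted_measurable.
- by move=> u /in0T; exact: (centered_ito_integral P_complete bm M_ito).
Qed.

Let integrable_Yt : P.-integrable setT (EFin \o Y t).
Proof.
apply: le_integrable integrable_1S => //.
  by apply/measurable_EFinP; apply: adapted_measurable (in0T _); rewrite ?lexx.
move=> w _; rewrite [leRHS]gee0_abs; last by rewrite adde_ge0.
by have := @grid_le_S 0 0 w (leq0n 1); rewrite grid0.
Qed.

Let mYt : measurable_fun setT (Y t).
Proof. by apply: adapted_measurable (in0T _); rewrite ?lexx. Qed.

Let Ft_sub : F t `<=` measurable. Proof. exact: Fm. Qed.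

Let integral_bound tau C : stopping_time_from T F t tau -> F t C ->
  (\int[P]_(w in C) (Y t w + (M (tau w) w - M t w))%:E = \int[P]_(w in C) (Y t w)%:E)%E.
Proof.
move=> stau FC; have mC := Ft_sub FC; have [iM M0] := centered_M stau.
under eq_integral do rewrite EFinD.
rewrite integralD_EFin//; [|exact: integrableS integrable_Yt|exact: integrableS iM].
by rewrite (M0 _ FC) adde0.
Qed.

Let measurable_bound tau : stopping_time_from T F t tau ->
  measurable_fun setT (fun w => (Y t w + (M (tau w) w - M t w))%:E).
Proof.
move=> stau; have [/(measurable_int P)/measurable_EFinP mM _] := centered_M stau.
by apply/measurable_EFinP; exact: measurable_funD.
Qed.

(** Put on events of F t so as to serve both the conditional expectations and, with the whole space
    as event, the functional J. *)
Lemma integral_payoff_le tau C : stopping_time_from T F t tau -> F t C ->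
  (\int[P]_(w in C) (payoff T g xi L t tau w)%:E <= \int[P]_(w in C) (Y t w)%:E)%E.
Proof.
move=> stau FC; rewrite -(integral_bound stau FC); apply: ae_le_integral.
- exact: Ft_sub.
- by apply/measurable_EFinP; exact: measurable_payoff.
- exact: measurable_bound.
- by apply: filterS (payoff_le stau) => w pw _; rewrite lee_fin.
Qed.

Lemma integral_payoff_first_contact C : F t C ->
  (\int[P]_(w in C) (payoff T g xi L t tau_star w)%:E = \int[P]_(w in C) (Y t w)%:E)%E.
Proof.
move=> FC; have stau := reflected_first_contact_stopping_time.
rewrite -(integral_bound stau FC); apply: ae_eq_integral.
- exact: Ft_sub.
- by apply: measurable_funTS; apply/measurable_EFinP; exact: measurable_payoff.
- by apply: measurable_funTS; exact: measurable_bound.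
- by apply: filterS payoff_first_contact => w pw _; rewrite pw.
Qed.

(** On the event [C n] where h exceeds Y t by at least 1/(n+1), integration gives E[Y t; C n] + P(C
    n)/(n+1) <= E[Y t; C n]. The finite integral of Y t cancels, whether or not h is integrable, so
    every [C n] is null. *)
Lemma cond_exp_payoff_le tau h : stopping_time_from T F t tau ->
  is_cond_exp P (F t) (EFin \o payoff T g xi L t tau) h ->
  {ae P, forall w, (h w <= (Y t w)%:E)%E}.
Proof.
move=> stau [_ _ mh hint].
pose C n : set Omega := [set w | ((Y t w + n.+1%:R^-1)%:E <= h w)%E].
have FC n : F t (C n).
  have sF := brownian_filtration_sigma_algebra P W t.
  have mhF := sub_measurable_sigmaType sF mh.
  have mYF : measurable_fun [set: g_sigma_algebraType (F t)] (Y t).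
    by apply: sub_measurable_sigmaType => //; apply: aY; apply: in0T; rewrite lexx.
  have mD : measurable_fun [set: g_sigma_algebraType (F t)]
      (fun w => h w - (Y t w + n.+1%:R^-1)%:E)%E.
    by apply: emeasurable_funB => //; apply/measurable_EFinP; exact: measurable_funD.
  rewrite -(filtration_measurableE (brownian_filtration_sigma_algebra P W) t).
  rewrite (_ : C n = (fun w => h w - (Y t w + n.+1%:R^-1)%:E)%E @^-1` `[0%E, +oo[%classic).
    by rewrite -[X in measurable X]setTI; apply: mD => //; exact: emeasurable_itv.
  have E w : (0 <= h w - (Y t w + n.+1%:R^-1)%:E)%E =
      ((Y t w + n.+1%:R^-1)%:E <= h w)%E by rewrite sube_ge0.
  by apply/seteqP; split => w; move: (E w); rewrite /C /= in_itv/= andbT => ->.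
have mC n : measurable (C n) := Ft_sub (FC n).
have PC n : P (C n) = 0%E.
  have c0 : 0 < n.+1%:R^-1 :> R by rewrite invr_gt0.
  have iY : P.-integrable (C n) (EFin \o Y t) by exact: integrableS integrable_Yt.
  have := integral_payoff_le stau (FC n); rewrite -(hint _ (FC n)) => hY.
  have : (\int[P]_(w in C n) ((Y t w)%:E + (n.+1%:R^-1)%:E) <= \int[P]_(w in C n) (Y t w)%:E)%E.
    apply: le_trans hY; apply: ae_le_integral => //.
    - by apply: emeasurable_funD => //; exact/measurable_EFinP.
    - exact: sub_measurable_fun mh.
    - by apply: aeW => w; rewrite /C /= EFinD.
  rewrite integralD_EFin//; last exact: finite_measure_integrable_cst.
  rewrite integral_cst// -[leRHS]adde0 leeD2lE; last exact: integrable_fin_num iY.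
  rewrite pmule_rle0 ?lte_fin// => PC0.
  by apply/eqP; rewrite eq_le PC0 measure_ge0.
have : P.-negligible (\bigcup_n C n).
  by apply: negligible_bigcup => n; exists (C n); split; [exact: mC|exact: PC|].
apply: negligibleS.
move=> w /= /negP; rewrite -ltNge => Yh.
(* Where h is +oo every margin works, and the value -oo contradicts Y t < h. *)
have [x xh] : exists n, ((Y t w + n.+1%:R^-1)%:E <= h w)%E.
  move: Yh; case: (h w) => [r|_|//]; last by exists 0; rewrite leey.
  rewrite lte_fin -subr_gt0 => Yr.
  have [m _ /(_ m (leqnn m))] := near_infty_natSinv_lt (PosNum Yr).
  by move=> /= mr; exists m; rewrite lee_fin -lerBrDl ltW.
by exists x.
Qed.

(** [V] is an arbitrary version because two are needed: Y t itself, which thereby enters the family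
    of the essential supremum, and the value process, whose F_t-measurability is obtained from Y t
    through the null sets of F_t. *)
Lemma cond_exp_payoff_first_contact V : {ae P, forall w, V w = (Y t w)%:E} ->
  measurable_fun setT V ->
  is_cond_exp P (F t) (EFin \o payoff T g xi L t tau_star) V.
Proof.
move=> VY mV; have stau := reflected_first_contact_stopping_time.
have mp : measurable_fun setT (EFin \o payoff T g xi L t tau_star).
  by apply/measurable_EFinP; exact: measurable_payoff.
have mY : measurable_fun setT (EFin \o Y t) by exact/measurable_EFinP.
split => //.
- left; have ip : P.-integrable setT (EFin \o payoff T g xi L t tau_star).
    have [iM _] := centered_M stau.
    have iYM : P.-integrable setT
        ((EFin \o Y t) \+ (EFin \o (fun w => M (tau_star w) w - M t w)%R))%E.
      exact: integrableD.
    apply/integrableP; split => //; have /integrableP[_] := iYM.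
    rewrite (ae_eq_integral (fun w => `|(EFin \o payoff T g xi L t tau_star) w|)%E)//.
    + exact: measurableT_comp (measurable_int _ iYM).
    + exact: measurableT_comp mp.
    + by apply: filterS payoff_first_contact => w pw _; rewrite /= pw.
  exact: integral_funepos_lt_pinfty ip.
- move=> _ [C mC <-]; rewrite setTI.
  apply: (filtration_negligible (brownian_filtration_sigma_algebra P W)
    (@negligible_brownian_filtration _ _ _ P W) (A := (EFin \o Y t) @^-1` C)).
    have YF : sub_measurable (F t) (Y t) by apply: aY; apply: in0T; rewrite lexx.
    apply: YF; exists (EFin @^-1` C); last by rewrite setTI.
    by rewrite -[X in measurable X]setTI; exact: EFin_measurable.
  apply: negligibleS VY => w [] [/= C1 C2] E.
    by apply: C2; rewrite E.
  by apply: C2; rewrite -E.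
- move=> C FC; rewrite [RHS](integral_payoff_first_contact FC).
  apply: ae_eq_integral; [exact: Ft_sub|exact: measurable_funTS|exact: measurable_funTS|].
  by apply: filterS VY.
Qed.

(** Y t dominates every member of the family and is one of them, hence is its essential supremum.
    The identity of Ytilde(t, t) with the value is thus derived rather than assumed. *)
Lemma value_first_contact V : is_value P T F g xi L t V ->
  {ae P, forall w, V w = (Y t w)%:E}.
Proof.
move=> [mV V_upper V_least].
have YV : {ae P, forall w, ((Y t w)%:E <= V w)%E}.
  apply: V_upper; exists tau_star; first exact: reflected_first_contact_stopping_time.
  apply: cond_exp_payoff_first_contact; first exact: aeW.
  exact/measurable_EFinP.
have VY : {ae P, forall w, (V w <= (Y t w)%:E)%E}.
  apply: (V_least (EFin \o Y t)); first exact/measurable_EFinP.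
  by move=> h [tau stau ce]; exact: cond_exp_payoff_le stau ce.
by apply: filterS2 YV VY => w YV VY; apply/eqP; rewrite eq_le VY.
Qed.

Lemma J_first_contact : J P T g xi L t tau_star =
  ereal_sup [set J P T g xi L t tau | tau in stopping_time_from T F t].
Proof.
have FT : F t setT.
  by have [F0 FC _] := brownian_filtration_sigma_algebra P W t; rewrite -(setD0 setT); exact: FC.
have stau := reflected_first_contact_stopping_time.
apply/eqP; rewrite eq_le; apply/andP; split.
  by apply: ereal_sup_ubound; exists tau_star.
apply: ge_ereal_sup => _ [tau stau' <-]; rewrite /J unlock.
by rewrite (integral_payoff_first_contact FT); exact: integral_payoff_le.
Qed.

End reflected_bsde.

Theorem proposition11 (R : realType)
    (d : measure_display) (Omega : measurableType d) (P : probability Omega R)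
    (T : R) (W : R -> Omega -> R)
    (dE : measure_display) (E : measurableType dE) (X : R -> Omega -> E)
    (f : R -> R -> E -> Omega -> R) (xi L : R -> Omega -> R)
    (Y : R -> Omega -> \bar R) (Yt Z K : R -> R -> Omega -> R)
    (T_gt0 : 0 < T)
    (P_complete : measure_is_complete P)
    (W_brownian : standard_brownian_motion P W T)
    (X_adapted : adapted T (brownian_filtration P W) X)
    (hA1 : assumption_A1 P T (brownian_filtration P W) xi)
    (hA2 : assumption_A2 P T (brownian_filtration P W) (driver f X) xi)
    (hA3 : assumption_A3 P T (brownian_filtration P W) xi L)
    (Yt_solution : forall t : R, 0 <= t <= T ->
       reflected_bsde_solution P T (brownian_filtration P W) (driver f X) xi L
         W t (Yt t) (Z t) (K t))
    (Y_value : forall t : R, 0 <= t <= T ->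
       is_value P T (brownian_filtration P W) (driver f X) xi L t (Y t)) :
  forall t : R, 0 <= t <= T ->
    [/\ stopping_time_from T (brownian_filtration P W) t
          (first_contact T L t (Yt t)),
        is_cond_exp P (brownian_filtration P W t)
          (EFin \o payoff T (driver f X) xi L t (first_contact T L t (Yt t)))
          (Y t) &
        J P T (driver f X) xi L t (first_contact T L t (Yt t))
        = ereal_sup
            [set J P T (driver f X) xi L t tau
            | tau in stopping_time_from T (brownian_filtration P W) t]].
Proof.
move=> t tT; have sol := Yt_solution t tT; have [M M_ito Y_eq] := rb_equation sol.
have g_prog := A2_progressive hA2 tT; have g_moment := A2_a hA2.
have L_adapted := A3_adapted hA3; have L_cont := A3_continuous hA3.
split.
- exact: (reflected_first_contact_stopping_time P_complete W_brownian tT g_prog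
    g_moment L_adapted L_cont sol M_ito Y_eq).
- apply: (cond_exp_payoff_first_contact P_complete W_brownian tT g_prog
    g_moment L_adapted L_cont sol M_ito Y_eq); last exact: es_measurable (Y_value t tT).
  exact: (value_first_contact P_complete W_brownian tT g_prog
    g_moment L_adapted L_cont sol M_ito Y_eq (Y_value t tT)).
- exact: (J_first_contact P_complete W_brownian tT g_prog
    g_moment L_adapted L_cont sol M_ito Y_eq).
Qed.
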